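(* Let $h:\mathbb R^n\to\mathbb R$ be a Legendre kernel with full domain ($C:=\operatorname{int}\operatorname{dom}h=\mathbb R^n$), let $f:\mathbb R^n\to\mathbb R$ be $L_f$-smooth relative to $h$, let $g:\mathbb R^n\to\mathbb R\cup\{\infty\}$ be proper and lsc, and let $\varphi=f+g$ satisfy $\operatorname*{argmin}\varphi\ne\emptyset$. Let $\gamma\in(0,1/L_f)$ and $\sigma\in(0,\frac{1-\gamma L_f}{\gamma})$, and consider the iterates $(x^k),(\bar x^k),(d^k)$ generated by the algorithm Bella with tolerance $\varepsilon=0$, assuming $\bar x^k\ne x^k$ for all $k$. Suppose that: (a) $\varphi$ is level bounded; (b) $f,h\in\mathcal C^2$ with $\nabla^2h\succ0$; (c) either $(\|d^k\|)_k$ has finite sum, or there exists $D\ge0$ such that $\|d^k\|\le D\|x^k-\bar x^k\|$ for all $k$; (d) $f,g,h$ are tame functions (e.g., semialgebraic). Then $(\|x^k-\bar x^k\|)_k$ has finite sum (in fact, regardless of whether or not (c) holds), and $(x^k)$ and $(\bar x^k)$ converge to a stationary point $x_\star$ of $\varphi$.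
   Context: A Legendre kernel is a proper, lsc, convex function $h$ with $\operatorname{int}\operatorname{dom}h\ne\emptyset$, $\mathcal C^1$ on $\operatorname{int}\operatorname{dom}h$, strictly convex, essentially smooth ($\|\nabla h(x_k)\|\to\infty$ whenever $\operatorname{int}\operatorname{dom}h\ni x_k$ converges to a boundary point of $\operatorname{dom}h$; void for full domain), and $1$-coercive ($\lim_{\|x\|\to\infty}h(x)/\|x\|=\infty$). Bregman distance: $\mathrm D_h(x,y)=h(x)-h(y)-\langle\nabla h(y),x-y\rangle$. $f$ is $L_f$-smooth relative to $h$ ($L_f\ge0$) if $L_fh\pm f$ are convex (on $\operatorname{int}\operatorname{dom}h=\mathbb R^n$); $1/L_f:=\infty$ if $L_f=0$. Bregman forward-backward map and envelope: $T_\gamma(x)=\operatorname*{argmin}_z\{f(x)+\langle\nabla f(x),z-x\rangle+g(z)+\frac1\gamma \mathrm D_h(z,x)\}$, and $\Phi_\gamma(x)$ is the infimum of the same expression over $z\in\mathbb R^n$. Algorithm Bella. Input: $\gamma\in(0,1/L_f)$, $x^0\in C$, $\sigma\in(0,\frac{1-\gamma L_f}\gamma)$, tolerance $\varepsilon\ge0$, $i_{\max}\in\mathbb N\cup\{\infty\}$. For $k=0,1,\dots$: (1) choose $\bar x^k\in T_\gamma(x^k)$; (2) if $\mathrm D_h(\bar x^k,x^k)\le\varepsilon$, stop and return $\bar x^k$; (3) choose any $d^k\in\mathbb R^n$; (4) for $i=0,1,2,\dots$ let $\tau_k=2^{-i}$ and $x^{k+1}=(1-\tau_k)\bar x^k+\tau_k(x^k+d^k)$,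 and accept $x^{k+1}$ at the first $i$ for which $\Phi_\gamma(x^{k+1})\le\Phi_\gamma(x^k)-\sigma \mathrm D_h(\bar x^k,x^k)$; if this inequality fails for $i=i_{\max}$, set instead $x^{k+1}=\bar x^k$. Level bounded: all sublevel sets are bounded. Stationary: $0\in\partial\varphi(x_\star)$, with $\partial$ the limiting (Mordukhovich) subdifferential. Tame functions: functions whose graphs are definable in a (common) o-minimal structure over the real field. *)

(* Defs.v *)
From HB Require Import structures.
From mathcomp Require Import all_boot all_order all_algebra.
From mathcomp Require Import all_classical all_reals all_analysis.

Set Implicit Arguments.
Unset Strict Implicit.
Unset Printing Implicit Defensive.

Import Order.TTheory GRing.Theory Num.Theory.
Import numFieldNormedType.Exports.

Local Open Scope classical_set_scope.
Local Open Scope ring_scope.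

(* The norm `|x| that the library puts on 'rV[R]_n is the sup norm. It is used
   only through the topology and the bounded sets it induces; every norm that
   occurs explicitly below is the Euclidean norm [enorm]. *)

Section euclidean.
Variables (R : realType) (n : nat).
Implicit Types (u v : 'rV[R]_n) (f : 'rV[R]_n -> R) (A : set 'rV[R]_n).

Definition dot u v : R := \sum_(i < n) u 0 i * v 0 i.

Definition enorm u : R := Num.sqrt (dot u u).

Definition grad f u : 'rV[R]_n := \row_(i < n) 'D_(delta_mx 0 i) f u.

Definition hess f u : 'M[R]_n := 'J (grad f) u.

Definition C1_on A f :=
  {in A, forall u, differentiable f u} /\ {within A, continuous (grad f)}.

Definition C2 f :=
  [/\ forall u, differentiable f u,
      forall u, differentiable (grad f) u & continuous (hess f)].

Definition posdef (M : 'M[R]_n) := forall v, v != 0 -> 0 < dot (v *m M) v.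

End euclidean.

Section extended_valued.
Variables (R : realType) (n : nat).
Implicit Types (u v z : 'rV[R]_n) (phi : 'rV[R]_n -> \bar R).
Local Open Scope ereal_scope.

Definition edom phi := [set u | phi u < +oo].

Definition eproper phi := (forall u, -oo < phi u) /\ edom phi !=set0.

Definition argmin phi := [set u | forall v, phi u <= phi v].

Definition level_bounded phi :=
  forall a : R, bounded_set [set u | phi u <= a%:E].

Definition regular_subdiff phi u : set 'rV[R]_n :=
  [set v | phi u \is a fin_num /\
    0 <= limf_einf
           (fun z => (phi z - phi u - (dot v (z - u))%:E) / (enorm (z - u))%:E)
           u^'].

Definition limiting_subdiff phi u : set 'rV[R]_n :=
  [set v | phi u \is a fin_num /\
    exists us vs : nat -> 'rV[R]_n,
      [/\ us @ \oo --> u, (phi \o us) @ \oo --> phi u,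
          forall k, regular_subdiff phi (us k) (vs k) & vs @ \oo --> v]].

Definition stationary phi u := limiting_subdiff phi u 0%R.

(* Only meant for functions that do not take the value -oo. *)
Definition econvex phi := forall u v (t : R), (0 < t < 1)%R ->
  phi (t *: u + (1 - t) *: v)%R <= t%:E * phi u + (1 - t)%:E * phi v.

Definition estrictly_convex phi := forall u v (t : R),
  edom phi u -> edom phi v -> u != v -> (0 < t < 1)%R ->
  phi (t *: u + (1 - t) *: v)%R < t%:E * phi u + (1 - t)%:E * phi v.

Definition essentially_smooth phi :=
  forall (us : nat -> 'rV[R]_n) u,
    (forall k, interior (edom phi) (us k)) ->
    (closure (edom phi) `\` interior (edom phi)) u ->
    us @ \oo --> u ->
    enorm (grad (fine \o phi) (us k)) @[k --> \oo] --> +oo%R.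

Definition one_coercive phi := forall M : R, exists r : R, forall u,
  (r < enorm u)%R -> M%:E < phi u / (enorm u)%:E.

Record legendre_kernel (h : 'rV[R]_n -> \bar R) : Prop := LegendreKernel {
  legendre_proper : eproper h;
  legendre_lsc : lower_semicontinuous h;
  legendre_convex : econvex h;
  legendre_interior : interior (edom h) !=set0;
  legendre_C1 : C1_on (interior (edom h)) (fine \o h);
  legendre_strictly_convex : estrictly_convex h;
  legendre_essentially_smooth : essentially_smooth h;
  legendre_coercive : one_coercive h }.

End extended_valued.

Section bregman.
Variables (R : realType) (n : nat) (f h : 'rV[R]_n -> R).
Variable g : 'rV[R]_n -> \bar R.

Definition bregman (x y : 'rV[R]_n) : R :=
  h x - h y - dot (grad h y) (x - y).

Definition relatively_smooth (L : R) :=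
  convex_function [set: convex_lmodType 'rV[R]_n] (fun x => L * h x + f x) /\
  convex_function [set: convex_lmodType 'rV[R]_n] (fun x => L * h x - f x).

Definition cost (x : 'rV[R]_n) : \bar R := ((f x)%:E + g x)%E.

Definition fb_model (gamma : R) (x z : 'rV[R]_n) : \bar R :=
  ((f x + dot (grad f x) (z - x))%:E + g z + (gamma^-1 * bregman z x)%:E)%E.

Definition fb_map (gamma : R) (x : 'rV[R]_n) : set 'rV[R]_n :=
  argmin (fb_model gamma x).

Definition fb_envelope (gamma : R) (x : 'rV[R]_n) : \bar R :=
  ereal_inf (range (fb_model gamma x)).

End bregman.

Section bella.
Variables (R : realType) (n : nat) (f h : 'rV[R]_n -> R).
Variable g : 'rV[R]_n -> \bar R.
Variables (gamma sigma eps : R).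
(* [None] stands for an infinite maximal number of backtracks. *)
Variable imax : option nat.

Definition bella_trial (x xbar d : 'rV[R]_n) (i : nat) : 'rV[R]_n :=
  (1 - 2 ^- i) *: xbar + 2 ^- i *: (x + d).

Definition bella_accept (x xbar d : 'rV[R]_n) (i : nat) : Prop :=
  (fb_envelope f h g gamma (bella_trial x xbar d i) <=
   fb_envelope f h g gamma x - (sigma * bregman h xbar x)%:E)%E.

Definition bella_linesearch (x xbar d xnext : 'rV[R]_n) : Prop :=
  (exists i, [/\ if imax is Some m then (i <= m)%N else true,
                 bella_accept x xbar d i,
                 forall j, (j < i)%N -> ~ bella_accept x xbar d j
               & xnext = bella_trial x xbar d i]) \/
  (exists m, [/\ imax = Some m,
                 forall j, (j <= m)%N -> ~ bella_accept x xbar d j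
               & xnext = xbar]).

(* Iteration [k] takes place only if no earlier iteration triggered the
   stopping test; what comes after a stop is left unconstrained. *)
Definition bella_run (x xbar d : nat -> 'rV[R]_n) : Prop :=
  forall k, (forall j, (j < k)%N -> eps < bregman h (xbar j) (x j)) ->
    fb_map f h g gamma (x k) (xbar k) /\
    (eps < bregman h (xbar k) (x k) ->
     bella_linesearch (x k) (xbar k) (d k) (x k.+1)).

End bella.

Section tame.
Variable R : realType.

(* [om_one] says that the definable subsets of the line are exactly the finite
   unions of intervals, points being the degenerate intervals; with [om_add]
   and [om_mul] it makes all real algebraic sets definable. *)
Record o_minimal (S : forall m, set (set 'rV[R]_m)) : Prop := OMinimal {
  om_set0 : forall m, S m set0;
  om_setU : forall m A B, S m A -> S m B -> S m (A `|` B);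
  om_setC : forall m A, S m A -> S m (~` A);
  om_prodl : forall m A, S m A -> S (1 + m)%N [set x | A (rsubmx x)];
  om_prodr : forall m A, S m A -> S (m + 1)%N [set x | A (lsubmx x)];
  om_proj : forall m (A : set 'rV[R]_(m + 1)), S (m + 1)%N A ->
    S m (lsubmx @` A);
  om_diag : forall m (i j : 'I_m), S m [set x | x 0 i = x 0 j];
  om_add : S 3 [set x | x 0 0 + x 0 1 = x 0 2];
  om_mul : S 3 [set x | x 0 0 * x 0 1 = x 0 2];
  om_one : forall A, S 1 A <-> exists s : seq (interval R),
    A = [set x | exists2 I, I \in s & x 0 0 \in I] }.

(* The graph of an extended-valued function is taken over its domain, as a
   subset of R^(n+1). *)
Definition egraph n (phi : 'rV[R]_n -> \bar R) : set 'rV[R]_(n + 1) :=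
  [set z | phi (lsubmx z) = (rsubmx z 0 0)%:E].

Definition tame3 n (f g h : 'rV[R]_n -> \bar R) :=
  exists S, [/\ o_minimal S, S _ (egraph f), S _ (egraph g) & S _ (egraph h)].

End tame.

(* Main.v *)
(* Put k = h/gamma - f. The forward-backward model is phi(z) + D_k(z, x), so the
   step z in T(x), of value t = Phi(x), carries the residual |x - z|. Two steps
   in a bounded set satisfy t - s <= C |x - y| (|x - y| + r(y)), where r is the
   residual: the envelope has slope at most C r. Let rho(t) be the least
   residual at level t, attained at a point theta(t) chosen lexicographically.
   In an o-minimal structure rho and the coordinates of theta are definable,
   hence monotone and right-continuous just above the limit level, so summing
   the slope estimate along theta gives
     t - s <= C (sup of rho on [s, t]) (Theta(t) - Theta(s)),
   with Theta the l1-length of theta. This is a derivative-free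
   Kurdyka-Lojasiewicz inequality. Combined with the sufficient decrease
   c r_k^2 <= t_k - t_(k+1) it yields c r_k <= Theta(t_k) - Theta(t_(k+1)), which
   telescopes. *)
Require Import Defs.
From mathcomp Require Import all_boot all_order all_algebra.
From mathcomp Require Import all_classical all_reals all_analysis.
From mathcomp Require Import ring lra.
Set Implicit Arguments.
Unset Strict Implicit.
Unset Printing Implicit Defensive.
Import Order.TTheory GRing.Theory Num.Theory.
Import numFieldNormedType.Exports.
Local Open Scope classical_set_scope.
Local Open Scope ring_scope.

(** * Definability *)

(** About the line, o-minimality is used in two forms: a definable property holds or fails
    throughout some interval []p, p + e[], and if countably many definable sets cover an interval,
    one of them contains a subinterval. Since the levels decrease strictly to their limit [p], germs
    to the right of [p] suffice. The obstacle to definability is the gradient inside the Bregman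
    distance, which is a limit; as k is convex and smooth, its gradient is the only subgradient, a
    first-order condition on the graph of k.

    All constants are local, so the steps must stay in a ball: level boundedness of the cost
    confines the points z, and 1-coercivity of h then confines the points x. On that ball, bounded
    Hessians make the gradient of k Lipschitz, which gives the slope C r; positive definiteness
    bounds the Bregman distance of h below by a multiple of r^2, which turns the line search test
    into sufficient decrease. If rho is nonincreasing near [p], residuals stay away from 0 and a
    linear Theta serves. Stationarity holds because the difference of the gradients of k at x and z
    is a regular subgradient of the cost at z. *)

Section definability.
Variables (R : realType) (S : forall m, set (set 'rV[R]_m)).
Hypothesis oS : o_minimal S.

Definition env_row m (e : nat -> R) : 'rV[R]_m := \row_i e i.

(* Formulas are predicates on valuations [nat -> R] that depend only on the
   first [m] variables; this avoids casts between the types ['rV_m]. *)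
Definition env_def m (P : (nat -> R) -> Prop) :=
  exists2 A, S A & forall e, P e <-> A (env_row m e).

Lemma env_def_ext m P Q : (forall e, P e <-> Q e) -> env_def m P -> env_def m Q.
Proof. by move=> PQ [A SA PA]; exists A => // e; rewrite -PQ. Qed.

Lemma env_def_congr m P : env_def m P ->
  forall e e', (forall i, (i < m)%N -> e i = e' i) -> P e -> P e'.
Proof.
move=> [A SA PA] e e' ee' /PA Pe; apply/PA.
suff -> : env_row m e' = env_row m e by [].
by apply/rowP => i; rewrite !mxE ee'.
Qed.

Lemma env_def_and m P Q : env_def m P -> env_def m Q ->
  env_def m (fun e => P e /\ Q e).
Proof.
move=> [A SA PA] [B SB QB]; exists (~` (~` A `|` ~` B)).
  by apply: (om_setC oS); apply: (om_setU oS); apply: (om_setC oS).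
by move=> e; rewrite PA QB setCU !setCK.
Qed.

Lemma env_def_not m P : env_def m P -> env_def m (fun e => ~ P e).
Proof.
move=> [A SA PA]; exists (~` A); first exact: (om_setC oS).
by move=> e; rewrite PA.
Qed.

Lemma env_def_true m : env_def m (fun=> True).
Proof.
exists (~` set0); first by apply: (om_setC oS); apply: (om_set0 oS).
by move=> e; rewrite setC0.
Qed.

Lemma env_def_all m k (P : nat -> (nat -> R) -> Prop) :
  (forall i, (i < k)%N -> env_def m (P i)) ->
  env_def m (fun e => forall i, (i < k)%N -> P i e).
Proof.
elim: k => [|k IHk] dP; first by apply: env_def_ext (env_def_true m).
apply: env_def_ext (env_def_and (IHk (fun i ik => dP i (ltnW ik))) (dP k (ltnSn k))).
move=> e; split=> [[Pe Pk] i|Pe]; last by split=> [i /ltnW|]; apply: Pe.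
by rewrite ltnS leq_eqVlt => /predU1P[->|/Pe].
Qed.

Lemma env_def_shift m k P : env_def m P ->
  env_def (k + m) (fun e => P (fun i => e (k + i)%N)).
Proof.
move=> dP; elim: k => [|k [A SA PA]]; first by apply: env_def_ext dP.
exists [set x : 'rV_(1 + (k + m)) | A (rsubmx x)]; first exact: (om_prodl oS).
move=> e; apply: iff_trans (PA (fun i => e i.+1)) _.
suff -> : env_row (k + m) (fun i => e i.+1) =
          rsubmx (env_row (k + m).+1 e : 'rV_(1 + (k + m))) by [].
by apply/rowP => i; rewrite !mxE.
Qed.

Lemma env_def_ex1 m P : env_def m.+1 P ->
  env_def m (fun e => exists r, P (fun i => if i == m then r else e i)).
Proof.
rewrite -addn1 => -[A SA PA]; exists (lsubmx @` A); first exact: (om_proj oS).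
move=> e; split=> [[r /PA Ar]|[z Az ze]].
  eexists; first exact: Ar.
  by apply/rowP => i; rewrite !mxE /= ltn_eqF.
exists (z 0 (rshift m 0)); apply/PA.
suff -> : env_row (m + 1) (fun i => if i == m then z 0 (rshift m 0) else e i) = z.
  by [].
apply/rowP => i; rewrite !mxE; case: (fintype.splitP i) => j ij.
  rewrite ij ltn_eqF //; have := congr1 (fun v : 'rV_m => v 0 j) ze.
  by rewrite !mxE => <-; congr (z 0 _); apply/val_inj.
rewrite ij (ord1 j) addn0 eqxx; congr (z 0 _); apply/val_inj => /=.
by rewrite ij (ord1 j).
Qed.

Lemma env_def_ex m k P : env_def (m + k) P ->
  env_def m (fun e => exists y : nat -> R,
    P (fun i => if (i < m)%N then e i else y (i - m)%N)).
Proof.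
elim: k P => [|k IHk] P dP.
  rewrite addn0 in dP; apply: (env_def_ext _ dP) => e; split=> [Pe|[y]].
    by exists e; apply: (env_def_congr dP) Pe => i ->.
  by apply: (env_def_congr dP) => i ->.
rewrite addnS in dP; apply: env_def_ext (IHk _ (env_def_ex1 dP)) => e.
split=> [[y [r Pr]]|[y Py]].
  exists (fun i => if i == k then r else y i).
  apply: (env_def_congr dP) Pr => i; rewrite ltnS => ik.
  have [->|ne_i] := eqVneq i (m + k)%N.
    by rewrite ltnNge leq_addr /= addKn eqxx.
  case: ltnP => // mi; case: eqP => // imk.
  by case/eqP: ne_i; rewrite -imk subnKC.
exists y, (y k); apply: (env_def_congr dP) Py => i ik.
by case: eqP => [->|//]; rewrite ltnNge leq_addr /= addKn.
Qed.

Lemma env_def_eq m i j : (i < m)%N -> (j < m)%N ->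
  env_def m (fun e => e i = e j).
Proof.
move=> im jm; exists [set x | x 0 (Ordinal im) = x 0 (Ordinal jm)].
  exact: (om_diag oS).
by move=> e; rewrite /= !mxE.
Qed.

(** Substitution of variables comes from diagonals and projections: [m] fresh variables are placed
    behind the first [k], equated with the variables [s i], fed to [P], and quantified away. *)
Lemma env_def_rename m k (s : nat -> nat) P :
  (forall i, (i < m)%N -> (s i < k)%N) -> env_def m P ->
  env_def k (fun e => P (e \o s)).
Proof.
move=> sk dP; have dE : env_def (k + m)
    (fun e => forall i, (i < m)%N -> e (k + i)%N = e (s i)).
  apply: env_def_all => i im; apply: env_def_eq; first by rewrite ltn_add2l.
  by rewrite ltn_addr ?sk.
apply: env_def_ext (env_def_ex (env_def_and (env_def_shift k dP) dE)) => e.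
split=> [[y [Py ys]]|Pe].
  apply: (env_def_congr dP) Py => i im; rewrite ys //=.
  by rewrite sk.
exists (e \o s); split.
  by apply: (env_def_congr dP) Pe => i im; rewrite ltnNge leq_addr /= addKn.
by move=> i im; rewrite (sk _ im) ltnNge leq_addr /= addKn.
Qed.

(* A type whose elements are faithfully described by finitely many real
   coordinates; [crd t i] is junk for [i >= arity]. *)
Class coords (T : Type) := Coords {
  arity : nat;
  crd : T -> nat -> R;
  crd_inj : forall t u, (forall i, (i < arity)%N -> crd t i = crd u i) -> t = u;
  crd_surj : forall e, exists t, forall i, (i < arity)%N -> crd t i = e i }.

Arguments arity T {_}.

Lemma real_crd_inj (t u : R) : (forall i, (i < 1)%N -> t = u) -> t = u.
Proof. by move=> /(_ 0%N); apply. Qed.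

Lemma real_crd_surj (e : nat -> R) : exists t, forall i, (i < 1)%N -> t = e i.
Proof. by exists (e 0%N); case. Qed.

#[global] Instance coords_real : coords R :=
  @Coords R 1 (fun r _ => r) real_crd_inj real_crd_surj.

Definition rV_crd n (v : 'rV[R]_n) i := if insub i is Some j then v 0 j else 0.

Lemma rV_crd_inj n (u v : 'rV[R]_n) :
  (forall i, (i < n)%N -> rV_crd u i = rV_crd v i) -> u = v.
Proof.
move=> uv; apply/rowP => i; have := uv i (ltn_ord i).
by rewrite /rV_crd valK.
Qed.

Lemma rV_crd_surj n e :
  exists v : 'rV[R]_n, forall i, (i < n)%N -> rV_crd v i = e i.
Proof. by exists (env_row n e) => i im; rewrite /rV_crd insubT /= mxE. Qed.

#[global] Instance coords_rV n : coords 'rV[R]_n :=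
  @Coords _ n (@rV_crd n) (@rV_crd_inj n) (@rV_crd_surj n).

Definition prod_crd T U {cT : coords T} {cU : coords U} (p : T * U) i :=
  if (i < arity T)%N then crd p.1 i else crd p.2 (i - arity T)%N.

Lemma prod_crdl T U {cT : coords T} {cU : coords U} (p : T * U) i :
  (i < arity T)%N -> prod_crd p i = crd p.1 i.
Proof. by rewrite /prod_crd => ->. Qed.

Lemma prod_crdr T U {cT : coords T} {cU : coords U} (p : T * U) i :
  prod_crd p (arity T + i) = crd p.2 i.
Proof. by rewrite /prod_crd ltnNge leq_addr addKn. Qed.

Lemma prod_crd_inj T U {cT : coords T} {cU : coords U} (p q : T * U) :
  (forall i, (i < arity T + arity U)%N -> prod_crd p i = prod_crd q i) -> p = q.
Proof.
case: p q => [t u] [t' u'] /= tu; congr pair; apply: crd_inj => i im.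
  by have := tu i; rewrite !prod_crdl //; apply; rewrite ltn_addr.
have := tu (@arity T cT + i)%N; rewrite !prod_crdr; apply.
by rewrite ltn_add2l.
Qed.

Lemma prod_crd_surj T U {cT : coords T} {cU : coords U} e :
  exists p : T * U, forall i, (i < arity T + arity U)%N -> prod_crd p i = e i.
Proof.
have [t te] := @crd_surj T cT e.
have [u ue] := @crd_surj U cU (fun i => e (@arity T cT + i)%N).
exists (t, u) => i im; rewrite /prod_crd /=; case: ltnP => [/te//|Ti].
by rewrite ue ?subnKC // ltn_subLR.
Qed.

#[global] Instance coords_prod T U (cT : coords T) (cU : coords U) :
    coords (T * U)%type :=
  @Coords _ (arity T + arity U) _ (@prod_crd_inj T U cT cU)
    (@prod_crd_surj T U cT cU).

(** * Definable predicates and functions on types with coordinates *)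

Definition definable T {cT : coords T} (P : T -> Prop) :=
  exists2 Q, env_def (arity T) Q & forall t, P t <-> Q (crd t).

Definition definable_fun T U {cT : coords T} {cU : coords U} (F : T -> U) :=
  definable (fun p : T * U => F p.1 = p.2).

Lemma definable_ext T {cT : coords T} (P Q : T -> Prop) :
  (forall t, P t <-> Q t) -> definable P -> definable Q.
Proof. by move=> PQ [A dA PA]; exists A => // t; rewrite -PQ. Qed.

Lemma definable_and T {cT : coords T} (P Q : T -> Prop) :
  definable P -> definable Q -> definable (fun t => P t /\ Q t).
Proof.
move=> [A dA PA] [B dB QB]; exists (fun e => A e /\ B e).
  exact: env_def_and.
by move=> t; rewrite PA QB.
Qed.

Lemma definable_not T {cT : coords T} (P : T -> Prop) :
  definable P -> definable (fun t => ~ P t).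
Proof.
move=> [A dA PA]; exists (fun e => ~ A e); first exact: env_def_not.
by move=> t; rewrite PA.
Qed.

Lemma definable_or T {cT : coords T} (P Q : T -> Prop) :
  definable P -> definable Q -> definable (fun t => P t \/ Q t).
Proof.
move=> dP dQ; apply: definable_ext
  (definable_not (definable_and (definable_not dP) (definable_not dQ))) => t.
by rewrite not_andE !notE.
Qed.

Lemma definable_imp T {cT : coords T} (P Q : T -> Prop) :
  definable P -> definable Q -> definable (fun t => P t -> Q t).
Proof.
move=> dP dQ; apply: definable_ext
  (definable_not (definable_and dP (definable_not dQ))) => t.
by rewrite implyE not_andE notE.
Qed.

(** Projection yields only a tuple of reals as witness; [crd_surj] turns it into an element of
    [U]. *)
Lemma definable_ex T U {cT : coords T} {cU : coords U} (P : T -> U -> Prop) :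
  definable (fun p : T * U => P p.1 p.2) -> definable (fun t => exists u, P t u).
Proof.
move=> [Q dQ PQ]; exists (fun e => exists y : nat -> R,
    Q (fun i => if (i < arity T)%N then e i else y (i - arity T)%N)).
  exact: env_def_ex dQ.
move=> t; split=> [[u /(PQ (t, u)) Qu]|[y Qy]]; first by exists (crd u).
have [u uy] := @crd_surj U cU y; exists u; apply/(PQ (t, u)).
apply: (env_def_congr dQ) Qy => i im; rewrite /= /prod_crd; case: ltnP => //= Ti.
by rewrite uy // ltn_subLR.
Qed.

Lemma definable_all T U {cT : coords T} {cU : coords U} (P : T -> U -> Prop) :
  definable (fun p : T * U => P p.1 p.2) -> definable (fun t => forall u, P t u).
Proof.
move=> dP; apply: definable_ext (definable_not
  (definable_ex (P := fun t u => ~ P t u) (definable_not dP))) => t.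
by rewrite -forallNE; split=> Pt u; have := Pt u; [exact: contrapT | move=> + nP; exact].
Qed.

(* [F] merely permutes, drops or repeats coordinates. *)
Definition reindexing T U {cT : coords T} {cU : coords U} (F : T -> U) :=
  exists2 s : nat -> nat, (forall i, (i < arity U)%N -> (s i < arity T)%N) &
    forall t i, (i < arity U)%N -> crd (F t) i = crd t (s i).

Lemma reindexing_id T {cT : coords T} : reindexing (fun t : T => t).
Proof. by exists id. Qed.

Lemma reindexing_fst T U V {cT : coords T} {cU : coords U} {cV : coords V}
  (F : T -> U * V) : reindexing F -> reindexing (fun t => (F t).1).
Proof.
move=> [s sT Fs]; exists s => [i iU|t i iU].
  by apply: sT; rewrite /= ltn_addr.
by rewrite -Fs /= ?prod_crdl // ltn_addr.
Qed.

Lemma reindexing_snd T U V {cT : coords T} {cU : coords U} {cV : coords V}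
  (F : T -> U * V) : reindexing F -> reindexing (fun t => (F t).2).
Proof.
move=> [s sT Fs]; exists (fun i => s (@arity U cU + i)%N) => [i iU|t i iU].
  by apply: sT; rewrite /= ltn_add2l.
by rewrite -Fs /= ?prod_crdr // ltn_add2l.
Qed.

Lemma reindexing_pair T U V {cT : coords T} {cU : coords U} {cV : coords V}
    (F : T -> U) (G : T -> V) :
  reindexing F -> reindexing G -> reindexing (fun t => (F t, G t)).
Proof.
move=> [s sT Fs] [s' s'T Gs'].
exists (fun i => if (i < @arity U cU)%N then s i else s' (i - @arity U cU)%N).
  move=> i /= iUV; case: (ltnP i) => [/sT//|Ui].
  by apply: s'T; rewrite ltn_subLR.
move=> t i /= iUV; rewrite /prod_crd; case: (ltnP i) => [/(Fs t)//|Ui] /=.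
by rewrite Gs' // ltn_subLR.
Qed.

Lemma reindexing_subst T U {cT : coords T} {cU : coords U} (F : T -> U)
    (P : U -> Prop) :
  reindexing F -> definable P -> definable (fun t => P (F t)).
Proof.
move=> [s sT Fs] [Q dQ PQ]; exists (fun e => Q (e \o s)).
  exact: env_def_rename dQ.
by move=> t; rewrite PQ; split; apply: (env_def_congr dQ) => i /Fs.
Qed.

Lemma reindexing_definable T U {cT : coords T} {cU : coords U} (F : T -> U) :
  reindexing F -> definable_fun F.
Proof.
move=> [s sT Fs]; exists (fun e => forall i, (i < @arity U cU)%N ->
    e (@arity T cT + i)%N = e (s i)).
  apply: env_def_all => i iU; apply: env_def_eq.
    by rewrite /= ltn_add2l.
  by rewrite /= ltn_addr ?sT.
move=> [t u] /=; split=> [<- i iU|tu].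
  by rewrite prod_crdr prod_crdl ?sT //= Fs.
apply: crd_inj => i iU; have := tu i iU.
by rewrite prod_crdr prod_crdl ?sT //= Fs.
Qed.

Ltac reindex := repeat
  first [ exact: reindexing_id | apply: reindexing_fst | apply: reindexing_snd
        | apply: reindexing_pair ].

(** An existential quantifier names the value of [F], so that only a projection has to be
    substituted into [P]. *)
Lemma definable_subst T U {cT : coords T} {cU : coords U} (F : T -> U)
    (P : U -> Prop) :
  definable_fun F -> definable P -> definable (fun t => P (F t)).
Proof.
move=> dF dP; apply: definable_ext (definable_ex (P := fun t u => F t = u /\ P u)
  (definable_and dF (reindexing_subst (F := snd) _ dP))) => [t|].
  by split=> [[u [->]]|Pt] //; exists (F t).
by reindex.
Qed.

Lemma definable_comp T U V {cT : coords T} {cU : coords U} {cV : coords V}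
    (F : T -> U) (G : U -> V) :
  definable_fun F -> definable_fun G -> definable_fun (fun t => G (F t)).
Proof.
move=> dF dG; apply: definable_ext (definable_ex
  (P := fun (p : T * V) u => F p.1 = u /\ G u = p.2)
  (definable_and
    (reindexing_subst (F := fun q : (T * V) * U => (q.1.1, q.2)) _ dF)
    (reindexing_subst (F := fun q : (T * V) * U => (q.2, q.1.2)) _ dG)))
    => [[t v] /=||]; [|by reindex|by reindex].
by split=> [[u [->]]|Pt] //; exists (F t).
Qed.

Lemma definable_pair T U V {cT : coords T} {cU : coords U} {cV : coords V}
    (F : T -> U) (G : T -> V) :
  definable_fun F -> definable_fun G -> definable_fun (fun t => (F t, G t)).
Proof.
move=> dF dG; apply: definable_ext (definable_and
    (reindexing_subst (F := fun q : T * (U * V) => (q.1, q.2.1)) _ dF)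
    (reindexing_subst (F := fun q : T * (U * V) => (q.1, q.2.2)) _ dG))
    => [[t [u v]] /=||]; [|by reindex|by reindex].
by split=> [[-> ->]|[-> ->]].
Qed.

Lemma definable_id T {cT : coords T} : definable_fun (fun t : T => t).
Proof. by apply: reindexing_definable; reindex. Qed.

Lemma definable_fst T U V {cT : coords T} {cU : coords U} {cV : coords V}
  (F : T -> U * V) : definable_fun F -> definable_fun (fun t => (F t).1).
Proof.
move=> dF; apply: definable_comp dF _.
by apply: reindexing_definable; reindex.
Qed.

Lemma definable_snd T U V {cT : coords T} {cU : coords U} {cV : coords V}
  (F : T -> U * V) : definable_fun F -> definable_fun (fun t => (F t).2).
Proof.
move=> dF; apply: definable_comp dF _.
by apply: reindexing_definable; reindex.
Qed.

Lemma definable_coord T {cT : coords T} n (F : T -> 'rV[R]_n) (i : 'I_n) :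
  definable_fun F -> definable_fun (fun t => F t 0 i).
Proof.
move=> dF; apply: (definable_comp dF (G := fun v : 'rV[R]_n => v 0 i)).
apply: reindexing_definable; exists (fun=> i) => [j _|v j _] /=.
  exact: ltn_ord.
by rewrite /rV_crd valK.
Qed.

Lemma definable_eq T U {cT : coords T} {cU : coords U} (F G : T -> U) :
  definable_fun F -> definable_fun G -> definable (fun t => F t = G t).
Proof.
move=> dF dG.
exact: (definable_subst (F := fun t => (t, G t)) (definable_pair (@definable_id T cT) dG) dF).
Qed.

(** Every finiteness argument below starts here: this is where the axioms restrict the definable
    sets instead of producing new ones. *)
Lemma definable_line (P : R -> Prop) : definable P ->
  exists s : seq (interval R), forall t, P t <-> exists2 I, I \in s & t \in I.
Proof.
move=> [Q [A SA QA] PQ]; have [s As] := (om_one oS A).1 SA.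
exists s => t; rewrite PQ QA As /=; split=> -[I Is tI]; exists I => //;
  by move: tI; rewrite mxE.
Qed.

(** Real parameters are allowed in formulas because a point is the degenerate interval [[c, c]]. *)
Lemma definable_cst T {cT : coords T} (c : R) : definable_fun (fun _ : T => c).
Proof.
apply: (reindexing_subst (F := snd) (P := fun r => c = r)); first by reindex.
exists (fun e => c = e 0%N) => //.
exists [set x | c = x 0 0]; last by move=> e; rewrite /= mxE.
apply/(om_one oS); exists [:: `[c, c] ]; apply/seteqP; split=> x /=.
  by move=> ->; exists `[x 0 0, x 0 0]; rewrite ?mem_head // in_itv /= lexx.
by move=> [I]; rewrite inE => /eqP ->; rewrite in_itv /= => /le_anti.
Qed.

Lemma definable_add T {cT : coords T} (F G : T -> R) :
  definable_fun F -> definable_fun G -> definable_fun (fun t => F t + G t).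
Proof.
move=> dF dG; apply: (definable_comp (definable_pair dF dG)
  (G := fun p : R * R => p.1 + p.2)).
exists (fun e => e 0%N + e 1%N = e 2%N) => //.
exists [set x | x 0 0 + x 0 1 = x 0 2]; first exact: (om_add oS).
by move=> e; rewrite /= !mxE.
Qed.

Lemma definable_mul T {cT : coords T} (F G : T -> R) :
  definable_fun F -> definable_fun G -> definable_fun (fun t => F t * G t).
Proof.
move=> dF dG; apply: (definable_comp (definable_pair dF dG)
  (G := fun p : R * R => p.1 * p.2)).
exists (fun e => e 0%N * e 1%N = e 2%N) => //.
exists [set x | x 0 0 * x 0 1 = x 0 2]; first exact: (om_mul oS).
by move=> e; rewrite /= !mxE.
Qed.

Lemma definable_fun_ext T U {cT : coords T} {cU : coords U} (F G : T -> U) :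
  F =1 G -> definable_fun F -> definable_fun G.
Proof. by move=> FG; apply: definable_ext => -[t u] /=; rewrite FG. Qed.

Lemma definable_opp T {cT : coords T} (F : T -> R) :
  definable_fun F -> definable_fun (fun t => - F t).
Proof.
move=> dF; apply: definable_fun_ext (definable_mul (@definable_cst T cT (-1)) dF).
by move=> t; rewrite mulN1r.
Qed.

(** The order is not primitive in [o_minimal]; it is recovered from the fact that the nonnegative
    reals are the squares. *)
Lemma definable_le T {cT : coords T} (F G : T -> R) :
  definable_fun F -> definable_fun G -> definable (fun t => F t <= G t).
Proof.
move=> dF dG; apply: definable_ext (definable_ex
  (P := fun t r => F t + r * r = G t) _) => [t|].
  split=> [[r <-]|FG]; first by rewrite lerDl -expr2 sqr_ge0.
  by exists (Num.sqrt (G t - F t)); rewrite -expr2 sqr_sqrtr ?subr_ge0 // addrC subrK.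
apply: definable_eq; [apply: definable_add|]; last 1 first.
- by apply: definable_comp dG; apply: definable_fst; apply: definable_id.
- by apply: definable_comp dF; apply: definable_fst; apply: definable_id.
- by apply: definable_mul; apply: definable_snd; apply: definable_id.
Qed.

Lemma definable_lt T {cT : coords T} (F G : T -> R) :
  definable_fun F -> definable_fun G -> definable (fun t => F t < G t).
Proof.
move=> dF dG; apply: definable_ext (definable_not (definable_le dG dF)) => t.
by rewrite ltNge; split=> /negP.
Qed.

Lemma definable_sum T {cT : coords T} n (F : 'I_n -> T -> R) :
  (forall i, definable_fun (F i)) -> definable_fun (fun t => \sum_i F i t).
Proof.
move=> dF; apply: (definable_fun_ext (F := fun t => \sum_(i <- index_enum _) F i t)) => //.
elim: (index_enum _) => [|i s IHs].
  by apply: definable_fun_ext (definable_cst 0) => t; rewrite big_nil.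
apply: definable_fun_ext (definable_add (dF i) IHs) => t.
by rewrite big_cons.
Qed.

Lemma definable_abs T {cT : coords T} (F : T -> R) :
  definable_fun F -> definable_fun (fun t => `|F t|).
Proof.
move=> dF; apply: (definable_ext (P := fun p : T * R => 0 <= p.2 /\ p.2 * p.2 = F p.1 * F p.1)).
  move=> [t r] /=; split=> [[r0 rF]|<-]; last by rewrite -normrM ger0_norm // -expr2 sqr_ge0.
  by apply/eqP; rewrite -(eqrXn2 (n := 2)) // real_normK ?num_real // !expr2 rF.
have dF1 : definable_fun (fun p : T * R => F p.1).
  by apply: definable_comp dF; apply: definable_fst; apply: definable_id.
have dr : definable_fun (fun p : T * R => p.2).
  by apply: definable_snd; apply: definable_id.
apply: definable_and; first by apply: definable_le dr; apply: definable_cst.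
by apply: definable_eq; apply: definable_mul.
Qed.

End definability.

(** * Definable functions of one variable *)

Section germs.
Variables (R : realType) (S : forall m, set (set 'rV[R]_m)).
Hypothesis oS : o_minimal S.

(** The point [p] itself is excluded: it will be the limit level, which the iterates approach
    strictly from above. *)
Definition right_germ (p : R) (P : R -> Prop) :=
  exists2 e, 0 < e & forall x, p < x -> x < p + e -> P x.

Lemma common_radius (d e : R) : 0 < d -> 0 < e ->
  exists m, [/\ 0 < m, m <= d & m <= e].
Proof.
by exists (Num.min d e); split; rewrite ?lt_min ?ge_min ?lexx ?orbT //; apply/andP.
Qed.

Lemma right_germ_and p P Q : right_germ p P -> right_germ p Q ->
  right_germ p (fun x => P x /\ Q x).
Proof.
move=> [d d0 Pd] [e e0 Qe]; exists (Num.min d e); first by rewrite lt_min d0.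
move=> x px; rewrite -ltrBlDl lt_min !ltrBlDl => /andP[xd xe].
by split; [apply: Pd | apply: Qe].
Qed.

Lemma right_germ_imp p (P Q : R -> Prop) : (forall x, p < x -> P x -> Q x) ->
  right_germ p P -> right_germ p Q.
Proof. by move=> PQ [e e0 Pe]; exists e => // x px /(Pe _ px); apply: PQ. Qed.

Lemma right_germ_near p (P : R -> Prop) e : right_germ p P -> 0 < e ->
  exists x, [/\ p < x, x < p + e & P x].
Proof.
move=> [d d0 Pd] e0; have m0 : 0 < Num.min d e by rewrite lt_min d0.
have md : Num.min d e <= d by rewrite ge_min lexx.
have me : Num.min d e <= e by rewrite ge_min lexx orbT.
exists (p + Num.min d e / 2); split; [lra|lra|apply: Pd; lra].
Qed.

(** If [I] has points arbitrarily close to [p] on the right, then by convexity it contains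
    everything between [p] and any one of them. *)
Lemma interval_right_germ (I : interval R) p :
  right_germ p (fun x => x \in I) \/ right_germ p (fun x => x \notin I).
Proof.
have [?|nI] := pselect (right_germ p (fun x => x \notin I)); [by right|left].
have meet e : 0 < e -> exists x, [/\ p < x, x < p + e & x \in I].
  move=> e0; apply: contrapT => nx; apply: nI; exists e => // x px xe.
  by apply/negP => xI; apply: nx; exists x.
have [x0 [px0 _ x0I]] := meet 1 ltr01.
exists (x0 - p); first by rewrite subr_gt0.
move=> x px; rewrite subrKC => xx0.
have [x1 [px1 + x1I]] := meet (x - p) ltac:(by rewrite subr_gt0).
rewrite subrKC => x1x; apply: (interval_is_interval x1I x0I).
by rewrite !ltW.
Qed.

(** The dichotomy holds for each interval of a finite union, hence for the union: a definable
    property cannot alternate infinitely often just to the right of a point. *)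
Lemma definable_right_germ p P : definable S P ->
  right_germ p P \/ right_germ p (fun x => ~ P x).
Proof.
move=> /(definable_line oS)[s Ps].
suff : right_germ p (fun t => exists2 I, I \in s & t \in I) \/
       right_germ p (fun t => ~ exists2 I, I \in s & t \in I).
  by case=> G; [left|right]; apply: right_germ_imp G => x _; rewrite Ps.
elim: s {P Ps} => [|I s [sp|sn]].
- by right; exists 1 => // x _ _ [].
- by left; apply: right_germ_imp sp => x _ [J Js xJ]; exists J; rewrite // inE Js orbT.
have [Ip|In] := interval_right_germ I p.
  by left; apply: right_germ_imp Ip => x _ xI; exists I; rewrite ?mem_head.
right; apply: right_germ_imp (right_germ_and sn In) => x _ [xs xI] [J].
by rewrite inE => /predU1P[->|Js] xJ; [rewrite xJ in xI | apply: xs; exists J].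
Qed.

Lemma definable_right_germ_near p P : definable S P ->
  (forall e, 0 < e -> exists x, [/\ p < x, x < p + e & P x]) -> right_germ p P.
Proof.
move=> dP meet; have [//|[e e0 nP]] := definable_right_germ p dP.
by have [x [px xe /nP]] := meet e e0; case.
Qed.

(* A definable set without interior is finite, and a nondegenerate interval is
   uncountable. *)
Lemma definable_cover_interval (E : nat -> R -> Prop) p q : p < q ->
  (forall n, definable S (E n)) ->
  (forall x, p < x -> x < q -> exists n, E n x) ->
  exists n a b, [/\ p <= a, a < b, b <= q & forall x, a < x -> x < b -> E n x].
Proof.
move=> pq dE cov; apply: contrapT => nE.
have cE n : countable [set x | [/\ p < x, x < q & E n x]].
  have [s Es] := definable_line oS (dE n).
  apply: sub_countable (_ : countable (\bigcup_(I in [set` s])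
     ([set` I] `&` [set x | p < x < q]))).
    apply: subset_card_le => x [px xq /Es[I Is xI]]; exists I => //.
    by split=> //=; rewrite px.
  apply: bigcup_countable => [|I Is]; first exact/finite_set_countable/finite_seq.
  have [[x [xI xpq]]|n0] := pselect ([set` I] `&` [set x | p < x < q] !=set0); last first.
    by rewrite (_ : _ `&` _ = set0) ?countable0 //; apply/eqP/negPn/negP => /set0P.
  (* Two distinct points of [I] between [p] and [q] would enclose an interval on which [E n]
     holds. *)
  apply: (sub_countable (B := [set x])); last exact: countable1.
  apply: subset_card_le => y [yI ypq] /=.
  case: (ltgtP x y) => // xy; case: nE; exists n.
    exists x, y; move: xpq ypq => /andP[px xq] /andP[py yq]; split=> //; try exact: ltW.
    move=> z xz zy; apply/Es; exists I => //.
    by apply: (interval_is_interval xI yI); rewrite !ltW.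
  exists y, x; move: xpq ypq => /andP[px xq] /andP[py yq]; split=> //; try exact: ltW.
  move=> z xz zy; apply/Es; exists I => //.
  by apply: (interval_is_interval yI xI); rewrite !ltW.
have : countable [set` `]p, q[].
  apply: sub_countable (bigcup_countable (countableP setT) (fun n _ => cE n)).
  apply: subset_card_le => x /=; rewrite in_itv /= => /andP[px xq].
  by have [n En] := cov x px xq; exists n.
move=> /countable_lebesgue_measure0; rewrite lebesgue_measure_itv /= lte_fin pq.
by rewrite -EFinB => -[] /eqP; rewrite subr_eq0 => /eqP qp; rewrite qp ltxx in pq.
Qed.

End germs.

Ltac definability_step oS := lazymatch goal with
  | |- definable _ (fun t => @?P t /\ @?Q t) => apply: (definable_and oS)
  | |- definable _ (fun t => @?P t \/ @?Q t) => apply: (definable_or oS)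
  | |- definable _ (fun t => ~ @?P t) => apply: (definable_not oS)
  | |- definable _ (fun t => exists u, @?P t u) => apply: (definable_ex oS)
  | |- definable _ (fun t => forall u, @?P t u) =>
      first [apply: (definable_imp oS) | apply: (definable_all oS)]
  | |- definable _ (fun t => is_true (Order.le (@?F t) (@?G t))) =>
      apply: (definable_le oS)
  | |- definable _ (fun t => is_true (Order.lt (@?F t) (@?G t))) =>
      apply: (definable_lt oS)
  | |- definable _ (fun t => @?F t = @?G t) => apply: (definable_eq oS)
  | |- definable_fun _ (fun t => t) => exact: (definable_id oS)
  | |- definable_fun _ fst =>
      apply: (definable_fst oS); exact: (definable_id oS)
  | |- definable_fun _ snd =>
      apply: (definable_snd oS); exact: (definable_id oS)
  | |- definable_fun _ (fun t => (@?F t).1) => apply: (definable_fst oS)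
  | |- definable_fun _ (fun t => (@?F t).2) => apply: (definable_snd oS)
  | |- definable_fun _ (fun t => (@?F t, @?G t)) => apply: (definable_pair oS)
  | |- definable_fun _ (fun t => GRing.add (@?F t) (@?G t)) =>
      apply: (definable_add oS)
  | |- definable_fun _ (fun t => GRing.opp (@?F t)) => apply: (definable_opp oS)
  | |- definable_fun _ (fun t => GRing.mul (@?F t) (@?G t)) =>
      apply: (definable_mul oS)
  | |- definable_fun _ (fun t => Num.norm (@?F t)) => apply: (definable_abs oS)
  | |- definable_fun _ (fun t => fun_of_matrix (@?F t) _ _) =>
      apply: (definable_coord oS)
  | dv : definable_fun _ ?v |- definable_fun _ (fun t => ?v (@?F t)) =>
      apply: (definable_comp oS _ dv)
  | dP : definable _ ?P |- definable _ (fun t => ?P (@?F t)) =>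
      apply: (definable_subst oS _ dP)
  | |- definable_fun _ _ => exact: (definable_cst oS)
  end.

Ltac definability oS := repeat first [ eassumption | definability_step oS ].

Section monotonicity.
Variables (R : realType) (S : forall m, set (set 'rV[R]_m)).
Hypothesis oS : o_minimal S.


(** A countable set of scales: it turns a radius or a jump size that depends on the point into a
    countable cover, to which [definable_cover_interval] applies. *)
Lemma small_sequence : exists2 w : nat -> R, (forall n, 0 < w n) &
  forall d, 0 < d -> exists n, w n < d.
Proof.
exists (fun n => n.+1%:R^-1) => [n|d d0]; first by rewrite invr_gt0.
by have [n] := ltr_add_invr d0; rewrite add0r; exists n.
Qed.

Lemma definable_right_germ_pred T {cT : coords R T} (F : T -> R)
    (P : T -> R -> Prop) :
  definable_fun S F -> definable S (fun q : T * R => P q.1 q.2) ->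
  definable S (fun t => right_germ (F t) (P t)).
Proof.
move=> dF dP; apply: (definable_ext (P := fun t => exists e, 0 < e /\
    forall x, F t < x -> x < F t + e -> P t x)).
  by move=> t; split=> [[e [e0 Pe]]|[e e0 Pe]]; exists e.
definability oS.
have dG : definable_fun S (fun q : T * R * R => (q.1.1, q.2)) by definability oS.
exact: (definable_subst oS dG dP).
Qed.

(** By the dichotomy, failure means that every [t] near [p] has an earlier [s] with [v s >= v t].
    Points after which [v] stays above all its earlier values are then shown to fill a right
    neighbourhood of [p], and on some subinterval they do so with a uniform width. There a point [x]
    and such a point [y] slightly to its left give [v s < v x] for all earlier [s], a
    contradiction. *)
Lemma incr_germ (v : R -> R) p e0 : definable_fun S v -> 0 < e0 ->
  (forall t, p < t -> t < p + e0 -> right_germ p (fun s => v s < v t)) ->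
  right_germ p (fun t => forall s, p < s -> s < t -> v s < v t).
Proof.
move=> dv e0gt0 low.
have [|[e1 e1gt0 nB]] := definable_right_germ oS p
  (P := fun t => forall s, p < s -> s < t -> v s < v t) ltac:(definability oS) => //.
(* A value [c] separates the values of [v] up to [a] from those just after [a]. *)
pose J a := exists c, (forall s, p < s -> s <= a -> v s < c) /\
  exists d, 0 < d /\ forall s, a < s -> s < a + d -> c <= v s.
have dJ : definable S J by rewrite /J; definability oS.
have [e2 e2gt0 J2] : right_germ p J.
  apply: (definable_right_germ_near oS) => // e egt0.
  have [t [pt te [t0 t1]]] : exists t, [/\ p < t, t < p + e & t < p + e0 /\ t < p + e1].
    have [m1 [m10 m1e m1e0]] := common_radius egt0 e0gt0.
    have [m [m0 mm1 me1]] := common_radius m10 e1gt0.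
    by exists (p + m / 2); split; [lra|lra|split; lra].
  have [d d0 dlow] := low t pt t0.
  have {}nB a : p < a -> a <= t -> exists s, [/\ p < s, s < a & v a <= v s].
    move=> pa at'; have := nB a pa (le_lt_trans at' t1).
    move=> /existsNP[s /not_implyP[ps /not_implyP[sa /negP]]].
    by rewrite -leNgt => vas; exists s.
  (* By [nB], each point of [A] has an earlier point of [A]. So the infimum is not attained, [v] is
     below [v t] up to [inf A], and [A] accumulates there from the right: [J (inf A)] holds with
     [c = v t]. *)
  pose A := [set s | [/\ p < s, s < t & v t <= v s]].
  have lbA : lbound A (p + d).
    move=> s [ps st vts]; rewrite leNgt; apply/negP => /(dlow _ ps).
    by rewrite ltNge vts.
  have [s0 [ps0 s0t vs0]] := nB t pt (lexx t).
  have infA : has_inf A by split; [exists s0|exists (p + d)].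
  have pA : p + d <= inf A by apply: lb_le_inf => //; exists s0.
  have At : inf A < t by apply: le_lt_trans (s0t); apply: ge_inf; [exists (p + d)|].
  have pA' : p < inf A by lra.
  have A_below s : p < s -> s <= inf A -> v s < v t.
    move=> ps sA; rewrite ltNge; apply/negP => vts.
    have [s' [ps' s's vss']] := nB s ps (le_trans sA (ltW At)).
    have : inf A <= s'.
      apply: ge_inf; first by exists (p + d).
      by split=> //; [lra | exact: le_trans vss'].
    lra.
  exists (inf A); split=> //; first by lra.
  exists (v t); split=> //.
  have [d' d'0 vd'] : right_germ (inf A) (fun s => v t <= v s).
    apply: (definable_right_germ_near oS); first by definability oS.
    move=> e' e'0; have [s [ps st vts] sA] := inf_adherent e'0 infA.
    exists s; split=> //; rewrite ltNge; apply/negP => /(A_below s ps).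
    by rewrite ltNge vts.
  by exists d'.
have [e3 [e3gt0 e31 e32]] := common_radius e1gt0 e2gt0.
have [w w0 w_small] := small_sequence.
pose E n a := exists c, (forall s, p < s -> s <= a -> v s < c) /\
  forall s, a < s -> s < a + w n -> c <= v s.
have [|n|x px xe|n [a [b [pa ab be Eab]]]] :=
    definable_cover_interval oS (E := E) (p := p) (q := p + e3).
- lra.
- by rewrite /E; definability oS.
- have [c [lec [d [d0 cv]]]] := J2 x px ltac:(lra).
  have [n nd] := w_small d d0.
  by exists n, c; split=> // s xs sx; apply: cv => //; lra.
have n0 := w0 n.
have [m [m0 mb mn]] : exists m, [/\ 0 < m, m <= b - a & m <= w n].
  by apply: common_radius => //; rewrite subr_gt0.
have [x [ax xm]] : exists x, a < x /\ x < a + m by exists (a + m / 2); split; lra.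
have [] := nB x; [lra|lra|move=> s ps sx].
(* [y] lies to the right of the counterexample [s] and within the uniform width of [x], so its
   separating value sits between [v s] and [v x]. *)
have [y [ay sy yx]] : exists y, [/\ a < y, s < y & y < x].
  have [d [d0 ds da]] : exists d, [/\ 0 < d, d <= x - s & d <= x - a].
    by apply: common_radius; rewrite subr_gt0.
  by exists (x - d / 2); split; lra.
have [c [lec cge]] := Eab y ay ltac:(lra).
by apply: lt_le_trans (cge x _ _); [apply: lec => //; lra|lra|lra].
Qed.

Definition ndecr_germ (v : R -> R) p := right_germ p (fun t =>
  forall s, p < s -> s < t -> v s <= v t).

(** Compare [v t] with the values of [v] just to the right of [p]. By the dichotomy, applied in [s]
    and then in [t], for all [t] near [p] these values are below [v t], or all above, or all equal
    to it. [incr_germ] settles the first two cases; in the third [v] is constant near [p]. *)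
Lemma monotone_germ (v : R -> R) p : definable_fun S v ->
  ndecr_germ v p \/ ndecr_germ (fun t => - v t) p.
Proof.
move=> dv; pose L t := right_germ p (fun s => v s < v t).
pose G t := right_germ p (fun s => - v s < - v t).
have dL : definable S L.
  by apply: definable_right_germ_pred; definability oS.
have dG : definable S G.
  by apply: definable_right_germ_pred; definability oS.
have [[e e0 eL]|nL] := definable_right_germ oS p dL.
  left; apply: right_germ_imp (incr_germ dv e0 eL) => x _ + s ps sx.
  by move=> /(_ s ps sx)/ltW.
have [[e e0 eG]|nG] := definable_right_germ oS p dG.
  have dNv : definable_fun S (fun t => - v t) by definability oS.
  right; apply: right_germ_imp (incr_germ dNv e0 eG) => x _ + s ps sx.
  by move=> /(_ s ps sx)/ltW.
have E : right_germ p (fun t => right_germ p (fun s => v s = v t)).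
  apply: right_germ_imp (right_germ_and nL nG) => t _ [nLt nGt].
  have [//|nlt] := definable_right_germ oS p (P := fun s => v s < v t)
    ltac:(definability oS).
  have [//|ngt] := definable_right_germ oS p (P := fun s => - v s < - v t)
    ltac:(definability oS).
  apply: right_germ_imp (right_germ_and nlt ngt) => s _ [/negP + /negP].
  by rewrite -!leNgt lerN2 => ? ?; apply/le_anti/andP.
left; have [e e0 Ee] := E; exists e => // t pt te s ps st.
have := right_germ_and (Ee s ps (lt_trans st te)) (Ee t pt te).
by move=> /right_germ_near/(_ ltr01)[x [_ _ [<- ->]]].
Qed.

(** Otherwise [v] jumps to the right of every point near [p], and on some subinterval the jumps are
    at least a fixed [w n]. Infinitely many such jumps cannot fit between two finite values of the
    nondecreasing [v]. *)
Lemma right_continuous_germ (v : R -> R) p : definable_fun S v ->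
  ndecr_germ v p -> right_germ p (fun a =>
    forall mu, 0 < mu -> right_germ a (fun b => v b < v a + mu)).
Proof.
move=> dv [e e0 vle].
have dC : definable S (fun a =>
    forall mu, 0 < mu -> right_germ a (fun b => v b < v a + mu)).
  by definability oS; apply: definable_right_germ_pred; definability oS.
have [//|[e1 e1gt0 nC]] := definable_right_germ oS p dC.
have [e2 [e2gt0 e2e e21]] := common_radius e0 e1gt0.
have [w w0 w_small] := small_sequence.
pose E n a := forall b, a < b -> b < p + e2 -> v a + w n <= v b.
have [|n|x px xe|n [a [b [pa ab be Eab]]]] :=
    definable_cover_interval oS (E := E) (p := p) (q := p + e2).
- lra.
- by rewrite /E; definability oS.
- have := nC x px ltac:(lra).
  move=> /existsNP[mu /not_implyP[mu0 nx]].
  have [n nmu] := w_small mu mu0.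
  exists n => b xb bp; have [//|high] := definable_right_germ oS x
    (P := fun b => v b < v x + mu) ltac:(definability oS).
  have [y [xy yb /negP]] := right_germ_near high (e := b - x) ltac:(lra).
  rewrite -leNgt => vxy; have : v y <= v b by apply: vle; lra.
  lra.
have n0 := w0 n.
(* One jump is spent on each halving of the remaining distance to [y]. *)
have climb k : forall x y, a < x -> x < y -> y < b ->
    v x + k%:R * w n <= v y.
  elim: k => [|k IHk] x y ax xy yb.
    by rewrite mul0r addr0; apply: vle => //; lra.
  have := IHk x ((x + y) / 2) ax ltac:(lra) ltac:(lra).
  have := Eab ((x + y) / 2) ltac:(lra) ltac:(lra) y ltac:(lra) ltac:(lra).
  have -> : k.+1%:R * w n = k%:R * w n + w n by rewrite -natr1 mulrDl mul1r.
  lra.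
pose x := a + (b - a) / 3; pose y := a + (b - a) / 3 * 2.
have [k] : exists k : nat, (v y - v x) / w n < k%:R.
  exists (Num.truncn ((v y - v x) / w n)).+1; exact: truncnS_gt.
rewrite ltr_pdivrMr // => vk.
have := climb k x y; rewrite /x /y => /(_ ltac:(lra) ltac:(lra) ltac:(lra)).
rewrite -/x -/y; lra.
Qed.

End monotonicity.

(** * Desingularization *)

Section l1norm.
Variables (R : realType) (n : nat).
Implicit Types (u v : 'rV[R]_n).

Definition l1norm u : R := \sum_i `|u 0 i|.

Lemma l1norm_ge0 u : 0 <= l1norm u.
Proof. exact: sumr_ge0. Qed.

Lemma l1normN u : l1norm (- u) = l1norm u.
Proof. by apply: eq_bigr => i _; rewrite mxE normrN. Qed.

Lemma l1normB u v : l1norm (u - v) = l1norm (v - u).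
Proof. by rewrite -l1normN opprB. Qed.

Lemma l1normD u v : l1norm (u + v) <= l1norm u + l1norm v.
Proof.
by rewrite -big_split; apply: ler_sum => i _; rewrite mxE ler_normD.
Qed.

Lemma coord_le_l1norm u i : `|u 0 i| <= l1norm u.
Proof. by rewrite /l1norm (bigD1 i) //= lerDl sumr_ge0. Qed.

End l1norm.

(** * Selection of minimizers in definable families of compact sets *)

Section selection.
Variables (R : realType) (S : forall m, set (set 'rV[R]_m)).
Hypothesis oS : o_minimal S.
Variables (W : topologicalType) (cW : coords R W).

Definition compact_slices (P : R -> W -> Prop) :=
  forall t, compact [set w | P t w].

(** The minimizers in a slice form its intersection with a closed sublevel set of [c]. They are
    again compact, so that minimizations can be iterated. *)
Lemma definable_argmin (P : R -> W -> Prop) (c : W -> R) :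
  continuous c -> definable_fun S c ->
  definable S (fun q : R * W => P q.1 q.2) -> compact_slices P ->
  let Q t w := P t w /\ forall w', P t w' -> c w <= c w' in
  [/\ definable S (fun q : R * W => Q q.1 q.2), compact_slices Q &
    forall t, (exists w, P t w) -> exists w, Q t w].
Proof.
move=> cc dc dP kP Q.
have argminP t : (exists w, P t w) -> exists w, Q t w.
  move=> Pt; have [|w] := @compact_EVT_min W R c [set w | P t w] Pt (kP t).
    exact: continuous_subspaceT.
  rewrite inE => Pw cw; exists w; split=> // w' Pw'.
  by apply: cw; rewrite inE.
split=> //.
- apply: (definable_and oS) => //.
  apply: (definable_all oS); apply: (definable_imp oS).
    have dG : definable_fun S (fun q : R * W * W => (q.1.1, q.2)) by definability oS.
    exact: (definable_subst oS dG dP).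
  by definability oS.
- move=> t; have [/argminP[w [Pw cw]]|nP] := pselect (exists w, P t w); last first.
    rewrite (_ : [set _ | _] = set0); first exact: compact0.
    by apply/seteqP; split=> // w [Pw _]; apply: nP; exists w.
  rewrite (_ : [set w' | Q t w'] = [set w' | P t w'] `&` [set w' | c w' <= c w]).
    apply: compact_closedI => //.
    apply: (@preimage_closed _ _ c [set x | x <= c w]); last exact: closed_le.
    by move=> x _; exact: cc.
  apply/seteqP; split=> w' [Pw'] /=; first by move=> /(_ w Pw).
  by move=> cw'; split=> // w'' /cw; apply: le_trans.
Qed.

(** A definable choice: minimizing the [c i] one after the other freezes each of them. The point [w]
    need not become unique, only its values [c i w] do. *)
Lemma definable_lexmin k (c : 'I_k -> W -> R) (P : R -> W -> Prop) :
  (forall i, continuous (c i)) -> (forall i, definable_fun S (c i)) ->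
  definable S (fun q : R * W => P q.1 q.2) -> compact_slices P ->
  exists Q : R -> W -> Prop, [/\ definable S (fun q : R * W => Q q.1 q.2),
    forall t w, Q t w -> P t w,
    forall t, (exists w, P t w) -> exists w, Q t w &
    forall i t w w', Q t w -> Q t w' -> c i w = c i w'].
Proof.
move=> cc dc dP kP.
have step : forall s : seq 'I_k,
    exists Q : R -> W -> Prop, [/\ definable S (fun q : R * W => Q q.1 q.2),
      compact_slices Q, forall t w, Q t w -> P t w,
      forall t, (exists w, P t w) -> exists w, Q t w &
      forall i t w w', i \in s -> Q t w -> Q t w' -> c i w = c i w'].
  elim=> [|j s [Q [dQ kQ QP PQ cQ]]]; first by exists P; split.
  have [dQ' kQ' QQ'] := definable_argmin (cc j) (dc j) dQ kQ.
  exists (fun t w => Q t w /\ forall w', Q t w' -> c j w <= c j w').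
  split=> // [t w [/QP]|t /PQ/QQ'|i t w w'] //.
  rewrite inE => /predU1P[->|si] [Qw cw] [Qw' cw']; last exact: cQ Qw Qw'.
  by apply/le_anti; rewrite cw ?cw'.
have [Q [dQ _ QP PQ cQ]] := step (enum 'I_k).
by exists Q; split=> // i t w w'; apply: cQ; rewrite mem_enum.
Qed.

Lemma definable_value (Q : R -> W -> Prop) (c : W -> R) :
  definable_fun S c -> definable S (fun q : R * W => Q q.1 q.2) ->
  (forall t w w', Q t w -> Q t w' -> c w = c w') ->
  exists2 v : R -> R, definable_fun S v & forall t w, Q t w -> v t = c w.
Proof.
move=> dc dQ cQ; pose G t a := exists w, Q t w /\ c w = a.
(* On empty slices [v] takes the default value 0, which accounts for the second disjunct in the
   formula for its graph. *)
pose v t := xget 0 (G t).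
have vG t w : Q t w -> v t = c w.
  move=> Qw; have [w' [Qw' <-]] : G t (v t) by apply: xgetI; exists w.
  exact: cQ Qw' Qw.
exists v => //.
have dG : definable S (fun q : R * R => exists w, Q q.1 w /\ c w = q.2).
  apply: (definable_ex oS); apply: (definable_and oS).
    have dF : definable_fun S (fun q : R * R * W => (q.1.1, q.2)) by definability oS.
    exact: (definable_subst oS dF dQ).
  by definability oS.
have dE : definable S (fun t : R => exists w, Q t w) by definability oS.
apply: (definable_ext (P := fun q : R * R => (exists w, Q q.1 w /\ c w = q.2) \/
    ~ (exists w, Q q.1 w) /\ 0 = q.2)).
  move=> [t a] /=; split=> [[[w [Qw <-]]|[nQ <-]]|<-].
  - exact: vG.
  - by apply: xgetPN => b [w [Qw _]]; apply: nQ; exists w.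
  - have [[w Qw]|nQ] := pselect (exists w, Q t w).
      by left; exists w; rewrite (vG t w).
    by right; split=> //; apply/esym/xgetPN => b [w [Qw _]]; apply: nQ; exists w.
apply: (definable_or oS) => //; apply: (definable_and oS); last by definability oS.
have dF : definable_fun S (fun q : R * R => q.1) by definability oS.
exact: (definable_not oS (definable_subst oS dF dE)).
Qed.

End selection.

Lemma right_germ_all (R : realType) k (p : R) (P : 'I_k -> R -> Prop) :
  (forall i, right_germ p (P i)) -> right_germ p (fun x => forall i, P i x).
Proof.
move=> Pg; suff : forall s : seq 'I_k,
    right_germ p (fun x => forall i, i \in s -> P i x).
  move=> /(_ (enum 'I_k)); apply: right_germ_imp => x _ Px i.
  by apply: Px; rewrite mem_enum.
elim=> [|j s IHs]; first by exists 1.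
apply: right_germ_imp (right_germ_and (Pg j) IHs) => x _ [Pj Ps] i.
by rewrite inE => /predU1P[->//|/Ps].
Qed.

Section desingularization.
Variables (R : realType) (S : forall m, set (set 'rV[R]_m)).
Hypothesis oS : o_minimal S.
Variables (n : nat) (W : topologicalType) (cW : coords R W).
Variables (pos : W -> 'rV[R]_n) (r : W -> R) (P : R -> W -> Prop).
Variables (p B C : R).
Hypothesis pos_cont : forall i, continuous (fun w => pos w 0 i).
Hypothesis pos_def : forall i, definable_fun S (fun w => pos w 0 i).
Hypothesis r_cont : continuous r.
Hypothesis r_def : definable_fun S r.
Hypothesis r_ge0 : forall w, 0 <= r w.
Hypothesis P_def : definable S (fun q : R * W => P q.1 q.2).
Hypothesis P_compact : compact_slices P.
Hypothesis P_bounded : forall t w i, P t w -> `|pos w 0 i| <= B.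
Hypothesis C_gt0 : 0 < C.
Hypothesis P_lip : forall s t w w', P t w -> P s w' -> t - s <=
  C * l1norm (pos w - pos w') * (l1norm (pos w - pos w') + r w').
Hypothesis P_near : forall e, 0 < e -> exists t, [/\ p < t, t < p + e & exists w, P t w].

(* A curve of minimal residual. Its coordinates being monotone, the l1-length
   of an arc is the sum of the increments of the coordinates. *)
Lemma talweg : exists (rho : R -> R) (th : 'I_n -> R -> R),
  [/\ definable_fun S rho, forall i, definable_fun S (th i) &
    right_germ p (fun t => (forall w, P t w -> rho t <= r w) /\
      exists w, [/\ P t w, r w = rho t & forall i, pos w 0 i = th i t])].
Proof.
have [dQ0 kQ0 PQ0] := definable_argmin oS r_cont r_def P_def P_compact.
have [Q [dQ QQ0 Q0Q cQ]] := definable_lexmin oS pos_cont pos_def dQ0 kQ0.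
have rQ t w w' : Q t w -> Q t w' -> r w = r w'.
  move=> /QQ0[Pw rw] /QQ0[Pw' rw'].
  by apply/le_anti; rewrite rw ?rw'.
have [rho drho rhoQ] := definable_value oS r_def dQ rQ.
have /choice[th thQ] : forall i : 'I_n, exists v : R -> R, definable_fun S v /\
    forall t w, Q t w -> v t = pos w 0 i.
  move=> i; have [v dv vQ] := definable_value oS (pos_def i) dQ (cQ i).
  by exists v.
exists rho, th; split=> //; first by move=> i; have [] := thQ i.
(* [P_near] provides points only at levels accumulating at [p]; definability extends this to every
   level just above [p]. *)
have dPE : definable S (fun t : R => exists w, P t w) by definability oS.
apply: right_germ_imp (definable_right_germ_near oS dPE P_near) => t _ Pt.
have [w Qw] := Q0Q t (PQ0 t Pt).
have [Pw rw] := QQ0 _ _ Qw.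
split=> [w' Pw'|]; first by rewrite (rhoQ t w Qw) rw.
exists w; split=> // [|i]; first by rewrite (rhoQ t w Qw).
by have [_ thi] := thQ i; rewrite (thi t w Qw).
Qed.

(** Over an arc of length [L] starting at level [a], the slope estimate gains at most
    [C * L * (L + rho a)]. Right-continuity makes [L] smaller than any slack [mu], which absorbs the
    quadratic term. Such arcs are chained from [s] to [t] by a supremum argument with [M + mu] in
    place of [M], and then [mu] tends to 0. *)
Lemma talweg_length : exists (rho Th : R -> R) (m : R),
  definable_fun S rho /\ right_germ p (fun t =>
   [/\ forall w, P t w -> rho t <= r w,
      m <= Th t, 0 <= rho t,
      forall s, p < s -> s < t -> Th s <= Th t &
      forall s M, p < s -> s < t -> 0 <= M ->
        (forall u, s <= u -> u <= t -> rho u <= M) ->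
        t - s <= C * M * (Th t - Th s)]).
Proof.
have [rho [th [drho dth germ0]]] := talweg.
(* Coordinates that decrease are replaced by their opposites, which preserves increments and values
   up to sign. *)
have /choice[up upP] : forall i : 'I_n, exists v : R -> R,
    [/\ definable_fun S v, ndecr_germ v p,
      forall s t, `|v t - v s| = `|th i t - th i s| &
      forall t, `|v t| = `|th i t|].
  move=> i; have dN : definable_fun S (fun t => - th i t).
    by have dthi := dth i; definability oS.
  have [inc|dec] := monotone_germ oS p (dth i).
    by exists (th i).
  by exists (fun t => - th i t); split=> // [s t|t]; rewrite -?opprD normrN.
have germ1 : right_germ p (fun t => forall i,
    (forall s, p < s -> s < t -> up i s <= up i t) /\
    (forall mu, 0 < mu -> right_germ t (fun b => up i b < up i t + mu))).
  apply: right_germ_all => i; have [dup inc _ _] := upP i.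
  exact: right_germ_and inc (right_continuous_germ oS dup inc).
have [e e0 germ] := right_germ_and germ0 germ1.
exists rho, (fun t => \sum_i up i t), (- (n%:R * B)); split=> //.
have rho_ge0 t : p < t -> t < p + e -> 0 <= rho t.
  by move=> pt te; have [[_ [w [_ <- _]]] _] := germ t pt te.
have Th_le s t : p < s -> s <= t -> t < p + e ->
    \sum_i up i s <= \sum_i up i t.
  move=> ps; rewrite le_eqVlt => /predU1P[->//|st] te; apply: ler_sum => i _.
  by have [_ /(_ i)[]] := germ t (lt_trans ps st) te => + _; apply.
have length s t w w' : p < s -> s <= t -> t < p + e ->
    (forall i, pos w 0 i = th i t) -> (forall i, pos w' 0 i = th i s) ->
    l1norm (pos w - pos w') = \sum_i up i t - \sum_i up i s.
  move=> ps st te wt w's; rewrite -sumrB; apply: eq_bigr => i _.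
  rewrite !mxE wt w's; have [_ _ <- _] := upP i; apply: ger0_norm.
  move: st; rewrite le_eqVlt => /predU1P[->|st]; first by rewrite subrr.
  rewrite subr_ge0; have [_ /(_ i)[]] := germ t (lt_trans ps st) te => + _.
  exact.
exists e => // t pt te; split.
- by have [[]] := germ t pt te.
- have [[_ [w [Pw _ wt]]] _] := germ t pt te.
  have -> : - (n%:R * B) = \sum_(i < n) - B.
    by rewrite sumr_const card_ord mulNrn mulr_natl.
  apply: ler_sum => i _; have [_ _ _ upth] := upP i.
  have := P_bounded i Pw; rewrite wt -upth ler_norml.
  by case/andP.
- exact: rho_ge0.
- by move=> s ps st; apply: Th_le => //; exact: ltW.
move=> s M ps st M0 rhoM.
pose D := \sum_i up i t - \sum_i up i s; rewrite -/D.
have D0 : 0 <= D by rewrite subr_ge0; apply: Th_le => //; exact: ltW.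
suff step mu : 0 < mu -> t - s <= C * (M + mu) * D.
  apply/ler_addgt0Pr => eps eps0.
  (* The summand 1 allows for [D = 0]. *)
  have CD1 : 0 < C * D + 1 by rewrite ltr_wpDl // mulr_ge0 // ltW.
  have := step (eps / (C * D + 1)) (divr_gt0 eps0 CD1).
  have -> : C * (M + eps / (C * D + 1)) * D =
      C * M * D + C * D * (eps / (C * D + 1)) by ring.
  move=> /le_trans; apply; rewrite lerD2l mulrA ler_pdivrMr // mulrC.
  by rewrite ler_pM2l //; lra.
(* The claim becomes [F s <= F t], and [A] collects the levels up to which it has been
   established. *)
move=> mu0; pose F u := C * (M + mu) * \sum_i up i u - u.
have CM0 : 0 <= C * (M + mu) by rewrite mulr_ge0 ?ltW // ltr_wpDl.
suff : F s <= F t by rewrite /F /D mulrBr; lra.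
pose A := [set u | [/\ s <= u, u <= t & F s <= F u]].
have ubA : ubound A t by move=> u [].
have As : A s by split=> //; exact: ltW.
have supA : has_sup A by split; [exists s | exists t].
have sA : s <= sup A by apply: ub_le_sup => //; exists t.
have At : sup A <= t by apply: ge_sup => //; exists s.
have FA : F s <= F (sup A).
  apply/ler_addgt0Pr => eps eps0.
  have [u [su ut Fu] uA] := sup_adherent eps0 supA.
  have uA' : u <= sup A by apply: ub_le_sup; [exists t|].
  have := Th_le u (sup A) ltac:(lra) uA' ltac:(lra).
  move=> /(ler_wpM2l CM0); rewrite /F in Fu *; lra.
have [<-//|ne_t] := eqVneq (sup A) t.
have {ne_t}At' : sup A < t by rewrite lt_neqAle ne_t.
have [[_ [w [Pw rw wA]]] cont] := germ (sup A) ltac:(lra) ltac:(lra).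
(* The [n] coordinates share the slack [mu]; the divisor [n.+1] covers [n = 0] as well. *)
have : right_germ (sup A) (fun b => forall i, up i b < up i (sup A) + mu / n.+1%:R).
  apply: right_germ_all => i; have [_ ] := cont i; apply.
  by rewrite divr_gt0.
move=> germA; have [b [Ab bt upb]] := right_germ_near germA (e := t - sup A) ltac:(lra).
have [[_ [w' [Pw' _ w'b]]] _] := germ b ltac:(lra) ltac:(lra).
have := P_lip Pw' Pw.
rewrite (length _ _ _ _ _ (ltW Ab) _ w'b wA); [|lra|lra].
rewrite rw; pose L := \sum_i up i b - \sum_i up i (sup A); rewrite -/L => bL.
have L0 : 0 <= L by rewrite subr_ge0; apply: Th_le; lra.
have Lmu : L <= mu.
  rewrite /L -sumrB; apply: (@le_trans _ _ (\sum_(i < n) mu / n.+1%:R)).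
    by apply: ler_sum => i _; rewrite lerBlDl ltW.
  rewrite sumr_const card_ord -[leLHS]mulr_natr mulrAC ler_pdivrMr //.
  by rewrite ler_pM2l // ler_nat.
have rM : rho (sup A) <= M by apply: rhoM.
have bA : b - sup A <= C * (M + mu) * L.
  apply: le_trans bL _; rewrite mulrAC; apply: ler_wpM2r => //.
  by apply: ler_wpM2l; [exact: ltW | lra].
have : b <= sup A.
  apply: ub_le_sup; first by exists t.
  split; [lra|lra|]; apply: le_trans FA _.
  by rewrite /F; rewrite /L mulrBr in bA; lra.
by rewrite leNgt Ab.
Qed.

(* Kurdyka-Lojasiewicz inequality: [Th] plays the role of the desingularizing
   function, and the inequality is integrated along levels instead of being
   stated with the derivative of [Th]. *)
Lemma desingularization : exists (Th : R -> R) (m e : R), [/\ 0 < e,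
  forall t, p < t -> t < p + e -> m <= Th t,
  forall s t, p < s -> s < t -> t < p + e -> Th s <= Th t &
  forall s t w, p < s -> s < t -> t < p + e -> P t w ->
    t - s <= r w * (Th t - Th s)].
Proof.
have [rho [Th [m [drho [e e0 germ]]]]] := talweg_length.
have [[e' e'0 inc]|[e' e'0 dec]] := monotone_germ oS p drho.
  have [d [d0 de de']] := common_radius e0 e'0.
  (* If [rho] is nondecreasing, its supremum on [[s, t]] is [rho t], which is at most [r w]. *)
  exists (fun t => C * Th t), (C * m), d; split=> // [t pt te|s t ps st td|s t w ps st td Pw].
  - by rewrite ler_pM2l //; have [] := germ t pt ltac:(lra).
  - rewrite ler_pM2l //; have [_ _ _ + _] := germ t ltac:(lra) ltac:(lra).
    exact.
  have [rhow _ rho0 Thst /(_ s (rho t) ps st rho0)] := germ t ltac:(lra) ltac:(lra).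
  move=> /(_ _)/le_trans; apply=> [u su|].
    rewrite le_eqVlt => /predU1P[->//|ut]; apply: inc; lra.
  rewrite -mulrBr mulrA [_ * C]mulrC; apply: ler_wpM2r.
    by rewrite subr_ge0; apply: Thst.
  by rewrite ler_pM2l //; apply: rhow.
have [d [d0 de de']] := common_radius e0 e'0.
pose t0 := p + d / 2.
(* If [rho] is nonincreasing and [rho t0 <= 0], then [M = 0] is admissible to the right of [t0], and
   an interval of levels of positive length would have length at most 0. *)
have rho0 : 0 < rho t0.
  rewrite ltNge; apply/negP => rho_le0.
  have [_ _ _ _ /(_ t0 0)] := germ (p + d / 4 * 3) ltac:(lra) ltac:(lra).
  move=> /(_ ltac:(rewrite /t0; lra) ltac:(rewrite /t0; lra) (lexx _)).
  have -> : p + d / 4 * 3 - t0 = d / 4 by rewrite /t0; lra.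
  rewrite mulr0 mul0r leNgt divr_gt0 //.
  suff dec0 : forall u, t0 <= u -> u <= p + d / 4 * 3 -> rho u <= 0 by move=> /(_ dec0).
  move=> u; rewrite le_eqVlt => /predU1P[<-//|t0u] ud.
  have := dec u ltac:(rewrite /t0 in t0u; lra) ltac:(lra) t0.
  move=> /(_ ltac:(rewrite /t0; lra) t0u); lra.
(* Residuals at levels below [t0] are at least [rho t0], so a linear function desingularizes. *)
exists (fun t => t / rho t0), (p / rho t0), (d / 2); split=> //.
- by rewrite divr_gt0.
- by move=> t pt _; rewrite ler_pM2r ?invr_gt0 // ltW.
- by move=> s t _ st _; rewrite ler_pM2r ?invr_gt0 // ltW.
move=> s t w ps st td Pw.
have [rhow _ _ _ _] := germ t ltac:(lra) ltac:(lra).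
have := dec t0 ltac:(rewrite /t0; lra) ltac:(rewrite /t0; lra) t ltac:(lra) td.
move=> rt; rewrite -mulrBl mulrCA ler_peMr ?subr_ge0 ?(ltW st) //.
by rewrite ler_pdivlMr // mul1r; have := rhow w Pw; lra.
Qed.

End desingularization.

(** * Estimates for smooth functions and Bregman distances *)

Lemma mulr_natl_sum (R : pzRingType) n (c : R) : n%:R * c = \sum_(i < n) c.
Proof. by rewrite sumr_const card_ord mulr_natl. Qed.

Section dot_product.
Variables (R : realType) (n : nat).
Implicit Types (u v w : 'rV[R]_n) (a : R).

Lemma dotC u v : dot u v = dot v u.
Proof. by apply: eq_bigr => i _; rewrite mulrC. Qed.

Lemma dotDl u v w : dot (u + v) w = dot u w + dot v w.
Proof. by rewrite -big_split; apply: eq_bigr => i _; rewrite mxE mulrDl. Qed.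

Lemma dotZl a u v : dot (a *: u) v = a * dot u v.
Proof. by rewrite /dot big_distrr /=; apply: eq_bigr => i _; rewrite mxE mulrA. Qed.

Lemma dotNl u v : dot (- u) v = - dot u v.
Proof. by rewrite -scaleN1r dotZl mulN1r. Qed.

Lemma dotDr u v w : dot w (u + v) = dot w u + dot w v.
Proof. by rewrite dotC dotDl !(dotC w). Qed.

Lemma dotZr a u v : dot v (a *: u) = a * dot v u.
Proof. by rewrite dotC dotZl dotC. Qed.

Lemma dotNr u v : dot v (- u) = - dot v u.
Proof. by rewrite dotC dotNl dotC. Qed.

Lemma dotBl u v w : dot (u - v) w = dot u w - dot v w.
Proof. by rewrite dotDl dotNl. Qed.

Lemma dotBr u v w : dot w (u - v) = dot w u - dot w v.
Proof. by rewrite dotDr dotNr. Qed.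

Lemma dot_self_ge0 u : 0 <= dot u u.
Proof. by apply: sumr_ge0 => i _; rewrite -expr2 sqr_ge0. Qed.

Lemma dot_self_eq0 u : dot u u <= 0 -> u = 0.
Proof.
move=> uu; have {uu}/eqP : dot u u = 0 by apply/le_anti; rewrite uu dot_self_ge0.
rewrite psumr_eq0 => [/allP u0|i _]; last by rewrite -expr2 sqr_ge0.
apply/rowP => i; have := u0 i; rewrite mem_index_enum => /(_ isT) /=.
by rewrite mulf_eq0 orbb mxE => /eqP.
Qed.

Lemma l1normZ a u : l1norm (a *: u) = `|a| * l1norm u.
Proof. by rewrite /l1norm big_distrr /=; apply: eq_bigr => i _; rewrite mxE normrM. Qed.

Lemma l1norm0 : l1norm (0 : 'rV[R]_n) = 0.
Proof. by rewrite -(scale0r 0) l1normZ normr0 mul0r. Qed.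

Lemma dot_delta u i : dot u (delta_mx 0 i) = u 0 i.
Proof.
rewrite /dot (bigD1 i) //= mxE !eqxx mulr1 big1 ?addr0 // => j ji.
by rewrite mxE eqxx (negbTE ji) mulr0.
Qed.

Lemma l1norm_delta i : l1norm (delta_mx 0 i : 'rV[R]_n) = 1.
Proof.
rewrite /l1norm (bigD1 i) //= mxE !eqxx normr1 big1 ?addr0 // => j ji.
by rewrite mxE eqxx (negbTE ji) normr0.
Qed.

Lemma norm_dot_le u v : `|dot u v| <= l1norm u * l1norm v.
Proof.
apply: le_trans (ler_norm_sum _ _ _) _; rewrite /l1norm big_distrl /=.
apply: ler_sum => i _; rewrite normrM ler_wpM2l //.
exact: coord_le_l1norm.
Qed.

Lemma l1norm_eq0 u : l1norm u <= 0 -> u = 0.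
Proof.
move=> u0; apply/rowP => i; rewrite mxE; apply/eqP; rewrite -normr_le0.
exact: le_trans (coord_le_l1norm u i) u0.
Qed.

Lemma enorm_ge0 u : 0 <= enorm u. Proof. exact: sqrtr_ge0. Qed.

Lemma enorm_le_l1norm u : enorm u <= l1norm u.
Proof.
rewrite -[leRHS]ger0_norm ?l1norm_ge0 // -sqrtr_sqr ler_wsqrtr // expr2.
exact: le_trans (ler_norm _) (norm_dot_le _ _).
Qed.

Lemma coord_le_enorm u i : `|u 0 i| <= enorm u.
Proof.
rewrite -sqrtr_sqr ler_wsqrtr // /dot (bigD1 i) //= expr2 lerDl.
by apply: sumr_ge0 => j _; rewrite -expr2 sqr_ge0.
Qed.

Lemma l1norm_le_enorm u : l1norm u <= n%:R * enorm u.
Proof.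
rewrite mulr_natl_sum.
by apply: ler_sum => i _; exact: coord_le_enorm.
Qed.

Lemma coord_le_norm u i : `|u 0 i| <= `|u|.
Proof.
rewrite [leRHS]/Num.Def.normr /= mx_normrE.
by apply/bigmax_geP; right => /=; exists (0, i).
Qed.

Lemma norm_le_l1norm u : `|u| <= l1norm u.
Proof.
rewrite [leLHS]/Num.Def.normr /= mx_normrE; apply/bigmax_leP; split=> [|[i j] _] /=.
  exact: l1norm_ge0.
by rewrite ord1 coord_le_l1norm.
Qed.

Lemma l1norm_le_norm u : l1norm u <= n%:R * `|u|.
Proof.
rewrite mulr_natl_sum.
by apply: ler_sum => i _; exact: coord_le_norm.
Qed.

Lemma sum_continuous (T : topologicalType) k (F : 'I_k -> T -> R) :
  (forall i, continuous (F i)) -> continuous (fun t => \sum_i F i t).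
Proof.
by move=> cF; apply: continuous_big => //; exact: add_continuous.
Qed.

Lemma coord_comp_continuous (T : topologicalType) (F : T -> 'rV[R]_n) i :
  continuous F -> continuous (fun t => F t 0 i).
Proof.
move=> cF t; apply: (@continuous_comp _ _ _ F (fun v : 'rV[R]_n => v 0 i)).
  exact: cF.
exact: coord_continuous.
Qed.

Lemma dot_continuous (T : topologicalType) (F G : T -> 'rV[R]_n) :
  continuous F -> continuous G -> continuous (fun t => dot (F t) (G t)).
Proof.
move=> cF cG; apply: sum_continuous => i t.
by apply: continuousM; exact: coord_comp_continuous.
Qed.

Lemma l1norm_continuous (T : topologicalType) (F : T -> 'rV[R]_n) :
  continuous F -> continuous (fun t => l1norm (F t)).
Proof.
move=> cF; apply: sum_continuous => i t.
apply: (@continuous_comp _ _ _ (fun t => F t 0 i) (fun r : R => `|r|)).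
  exact: coord_comp_continuous.
exact: norm_continuous.
Qed.

Lemma compact_l1ball rho : compact [set u : 'rV[R]_n | l1norm u <= rho].
Proof.
apply: bounded_closed_compact.
  exists rho; split; first exact: num_real.
  move=> M rM u /= ur; apply: le_trans (ltW rM).
  exact: le_trans (norm_le_l1norm u) ur.
apply: (@preimage_closed _ _ (@l1norm R n) [set x | x <= rho]); last exact: closed_le.
by move=> u _; apply: l1norm_continuous => t; exact: cvg_id.
Qed.

End dot_product.

Section smooth.
Variables (R : realType) (n : nat).
Implicit Types (f h : 'rV[R]_n -> R) (u v w x y z : 'rV[R]_n).

Lemma derive_grad f u w : differentiable f u -> 'D_w f u = dot (grad f u) w.
Proof.
move=> df; rewrite deriveE // [in LHS](row_sum_delta w) linear_sum.
by apply: eq_bigr => i _; rewrite linearZ mxE deriveE // mulrC.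
Qed.

Lemma line_is_derive (F : 'rV[R]_n -> R) x w (s : R) :
  derivable F (x + s *: w) w ->
  is_derive s 1 (fun s => F (x + s *: w)) ('D_w F (x + s *: w)).
Proof.
have E : (fun t : R => t^-1 *: ((((fun s => F (x + s *: w)) \o shift s) (t *: 1))
    - F (x + s *: w))) =
  (fun t => t^-1 *: (((F \o shift (x + s *: w)) (t *: w)) - F (x + s *: w))).
  apply/funext => t /=; congr (_ *: (F _ - _)).
  by rewrite scaler1 scalerDl addrCA.
by move=> dF; apply: DeriveDef; rewrite /derivable /derive E.
Qed.

Lemma line_mvt (F : 'rV[R]_n -> R) x w :
  (forall u, derivable F u w) ->
  exists s, [/\ 0 <= s, s <= 1 & F (x + w) - F x = 'D_w F (x + s *: w)].
Proof.
move=> dF; have dline s := line_is_derive (dF (x + s *: w)).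
have [|s] := @MVT_segment R (fun s => F (x + s *: w))
    (fun s => 'D_w F (x + s *: w)) 0 1 ler01 (fun s _ => dline s).
  apply: derivable_within_continuous => s _.
  exact: @ex_derive _ _ _ _ _ _ _ (dline s).
rewrite in_itv /= => /andP[s0 s1]; rewrite scale1r scale0r addr0 subr0 mulr1.
by exists s.
Qed.

Lemma grad_dot_derive f a u w : differentiable (grad f) u ->
  is_derive u w (fun u => dot (grad f u) a) (dot (w *m hess f u) a).
Proof.
move=> dg; have dgw : derivable (grad f) u w by exact: diff_derivable.
have di i : is_derive u w (fun u => grad f u 0 i) ((w *m hess f u) 0 i).
  apply: DeriveDef; first by move/derivable_mxP : dgw.
  by rewrite /hess -deriveEjacobian // derive_mx // mxE.
have := @is_derive_sum _ _ _ n (fun i => a 0 i \*: (fun u => grad f u 0 i)) u w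
  (fun i => a 0 i *: (w *m hess f u) 0 i) _.
rewrite (_ : \sum_(i < n) _ = (fun u => dot (grad f u) a)).
  rewrite (_ : \sum_(i < n) _ = dot (w *m hess f u) a); first by apply.
  by apply: eq_bigr => i _; rewrite mulrC.
apply/funext => v; rewrite fct_sumE; apply: eq_bigr => i _.
by rewrite mulrC.
Qed.

Lemma grad_mvt f a x w : (forall u, differentiable (grad f) u) ->
  exists s, [/\ 0 <= s, s <= 1 &
    dot (grad f (x + w) - grad f x) a = dot (w *m hess f (x + s *: w)) a].
Proof.
move=> dg; have dD u := grad_dot_derive a w (dg u).
have [u|s [s0 s1 E]] := @line_mvt (fun u => dot (grad f u) a) x w.
  exact: @ex_derive _ _ _ _ _ _ _ (dD u).
by exists s; rewrite dotBl E (@derive_val _ _ _ _ _ _ _ (dD _)).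
Qed.

Lemma l1ball_segment rho x w s : l1norm x <= rho -> l1norm (x + w) <= rho ->
  0 <= s -> s <= 1 -> l1norm (x + s *: w) <= rho.
Proof.
move=> xr xwr s0 s1.
have -> : x + s *: w = (1 - s) *: x + s *: (x + w).
  by rewrite scalerBl scale1r scalerDr addrA subrK.
apply: le_trans (l1normD _ _) _; rewrite !l1normZ !ger0_norm ?subr_ge0 //.
have := ler_wpM2l s0 xwr; have := @ler_wpM2l _ (1 - s) ltac:(lra) _ _ xr.
lra.
Qed.

Lemma grad_lipschitz f rho : C2 f -> exists2 C, 0 <= C & forall x y a,
  l1norm x <= rho -> l1norm y <= rho ->
  `|dot (grad f x - grad f y) a| <= C * l1norm (x - y) * l1norm a.
Proof.
move=> [df dg hc].
have : bounded_set (hess f @` [set u | l1norm u <= rho]).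
  apply: compact_bounded; apply: continuous_compact; last exact: compact_l1ball.
  exact: continuous_subspaceT.
(* [bounded_set] gives a bound for every number strictly above [M], hence the added 1. *)
move=> [M [_ bM]]; pose C := `|M| + 1.
have C0 : 0 <= C by rewrite addr_ge0.
have HC u i j : l1norm u <= rho -> `|hess f u i j| <= C.
  move=> ur; apply: le_trans (bM C _ _ _); last by exists u.
    rewrite [leRHS]/Num.Def.normr /= mx_normrE.
    by apply/bigmax_geP; right => /=; exists (i, j).
  by rewrite (le_lt_trans (ler_norm M)) // ltrDl.
exists (n%:R * C); first by rewrite mulr_ge0.
move=> x y a xr yr; rewrite -{1}(subrK y x) [_ - y + y]addrC.
have [s [s0 s1 ->]] := grad_mvt a y (x - y) dg.
apply: le_trans (norm_dot_le _ _) _; apply: ler_wpM2r; first exact: l1norm_ge0.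
rewrite -mulrA mulr_natl_sum.
apply: ler_sum => j _; rewrite mxE.
apply: le_trans (ler_norm_sum _ _ _) _; rewrite mulrC /l1norm big_distrl /=.
apply: ler_sum => i _; rewrite normrM; apply: ler_wpM2l => //.
by apply: HC; apply: l1ball_segment => //; rewrite addrC subrK.
Qed.

(** The quadratic form of the Hessian has a positive minimum over the compact product of the ball
    and the l1 unit sphere; the mean value theorem and homogeneity do the rest. *)
Lemma grad_strongly_monotone h rho : C2 h -> (forall z, posdef (hess h z)) ->
  exists2 c, 0 < c & forall x y, l1norm x <= rho -> l1norm y <= rho ->
    c * l1norm (x - y) ^+ 2 <= dot (grad h x - grad h y) (x - y).
Proof.
move=> [dh dg hc] pd.
pose A := [set u : 'rV[R]_n | l1norm u <= rho].
pose B := [set v : 'rV[R]_n | l1norm v <= 1] `&` [set v | l1norm v = 1].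
have cB : compact B.
  apply: compact_closedI; first exact: compact_l1ball.
  apply: (@preimage_closed _ _ (@l1norm R n) [set 1]); last exact: closed_eq.
  by move=> u _; apply: l1norm_continuous => t; exact: cvg_id.
have cAB : compact (A `*` B) by apply: compact_setX; first exact: compact_l1ball.
pose q (p : 'rV[R]_n * 'rV[R]_n) := dot (p.2 *m hess h p.1) p.2.
have cq : continuous q.
  have cfst i j : continuous (fun p : 'rV[R]_n * 'rV[R]_n => hess h p.1 i j).
    move=> p; apply: (@continuous_comp _ _ _
      (fun p : 'rV[R]_n * 'rV[R]_n => hess h p.1) (fun M : 'M[R]_n => M i j)).
      by apply: (@continuous_comp _ _ _ fst (hess h)); [exact: cvg_fst|exact: hc].
    exact: coord_continuous.
  have csnd i : continuous (fun p : 'rV[R]_n * 'rV[R]_n => p.2 0 i).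
    by apply: (@coord_comp_continuous _ _ _ snd) => p; exact: cvg_snd.
  apply: sum_continuous => j p; apply: continuousM; last exact: csnd.
  rewrite (_ : (fun p => _) = fun p : 'rV[R]_n * 'rV[R]_n =>
    \sum_i p.2 0 i * hess h p.1 i j); last by apply/funext => ?; rewrite mxE.
  apply: sum_continuous => i {}p.
  by apply: continuousM; [exact: csnd | exact: cfst].
have [c c0 cB'] : exists2 c, 0 < c & forall u v, A u -> B v -> c <= q (u, v).
  (* The product is empty when [rho < 0] or [n = 0]; any positive constant then works. *)
  have [AB0|nAB] := pselect (A `*` B !=set0); last first.
    by exists 1 => // u v Au Bv; case: nAB; exists (u, v).
  have [|[u v]] := @compact_EVT_min _ R q _ AB0 cAB.
    exact: continuous_subspaceT.
  rewrite inE => -[/= Au [_ v1]] qmin; exists (q (u, v)).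
    apply: pd; apply/eqP => /= v0; move: v1; rewrite /= v0 l1norm0.
    by move=> /eqP; rewrite eq_sym oner_eq0.
  by move=> u' v' Au' Bv'; apply: qmin; rewrite inE.
exists c => // x y xr yr.
have [->|xy] := eqVneq x y.
  by rewrite !subrr l1norm0 expr0n mulr0 dot_self_ge0.
have l0 : 0 < l1norm (x - y).
  rewrite lt_neqAle l1norm_ge0 andbT eq_sym; apply/eqP => l0.
  by case/eqP: xy; apply/eqP; rewrite -subr_eq0; apply/eqP/l1norm_eq0; rewrite l0.
rewrite -{2}(subrK y x) [_ - y + y]addrC.
have [s [s0 s1 ->]] := grad_mvt (x - y) y (x - y) dg.
set u := y + s *: (x - y).
have Au : A u by apply: l1ball_segment => //; rewrite addrC subrK.
set l := l1norm (x - y) in l0 *; pose v := l^-1 *: (x - y).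
have vl : l1norm v = 1.
  by rewrite l1normZ ger0_norm ?invr_ge0 ?ltW // mulVf // gt_eqF.
have -> : x - y = l *: v by rewrite scalerA mulfV ?scale1r // gt_eqF.
rewrite -scalemxAl dotZl dotZr mulrA -expr2 mulrC ler_pM2l ?exprn_gt0 //.
by apply: cB' => //; split=> //=; rewrite vl.
Qed.

End smooth.

Section bregman_distance.
Variables (R : realType) (n : nat).
Implicit Types (f h k : 'rV[R]_n -> R) (u v w x y z : 'rV[R]_n).

Definition convex_on_segments k := forall u v (t : R), 0 < t -> t < 1 ->
  k (t *: u + (1 - t) *: v) <= t * k u + (1 - t) * k v.

Lemma bregman_ge0 k z x : convex_on_segments k -> differentiable k x ->
  0 <= bregman k z x.
Proof.
move=> ck dk; rewrite /bregman subr_ge0 -derive_grad //.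
apply/ler_addgt0Pr => e e0; pose w := z - x.
have /cvgrPdist_le/(_ e e0)[/= r r0 near_r] :
  (fun t : R => t^-1 *: ((k \o shift x) (t *: w) - k x)) @ 0^' --> 'D_w k x.
  exact: diff_derivable.
have [t [t0 tr t1]] := common_radius (d := r / 2) (e := 1 / 2) ltac:(lra) ltac:(lra).
have := near_r t; rewrite /= sub0r normrN gtr0_norm // gt_eqF //.
move=> /(_ ltac:(lra) isT); rewrite ler_norml => /andP[_].
rewrite lerBlDr => /le_trans; apply; rewrite addrC lerD2r.
rewrite [_ *: _]mulrC ler_pdivrMr // lerBlDr.
have := ck z x t t0 ltac:(lra).
have -> : t *: z + (1 - t) *: x = t *: w + x.
  by rewrite /w scalerBl scale1r scalerBr [x - _]addrC addrA.
move=> /le_trans; apply; lra.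
Qed.

Lemma bregmanxx k x : bregman k x x = 0.
Proof. by rewrite /bregman !subrr -(scale0r (x - x)) dotZr mul0r subrr. Qed.

Lemma bregman_three_points k x y z : bregman k z x =
  bregman k z y + bregman k y x + dot (grad k y - grad k x) (z - y).
Proof.
by rewrite /bregman !dotBl !dotBr; ring.
Qed.

Lemma grad_lin h f (a b : R) x : differentiable h x -> differentiable f x ->
  grad (fun u => a * h u + b * f u) x = a *: grad h x + b *: grad f x.
Proof.
move=> dh df; apply/rowP => i; rewrite !mxE.
have Dh : is_derive x (delta_mx 0 i) h ('D_(delta_mx 0 i) h x).
  by apply/derivableP; exact: diff_derivable.
have Df : is_derive x (delta_mx 0 i) f ('D_(delta_mx 0 i) f x).
  by apply/derivableP; exact: diff_derivable.
exact: (@derive_val _ _ _ _ _ _ _ (is_deriveD (is_deriveZ a Dh) (is_deriveZ b Df))).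
Qed.

Lemma bregman_lin h f (a b : R) z x : differentiable h x -> differentiable f x ->
  bregman (fun u => a * h u + b * f u) z x = a * bregman h z x + b * bregman f z x.
Proof.
by move=> dh df; rewrite /bregman grad_lin // dotDl !dotZl; ring.
Qed.

(** For a subgradient [v], moving by [t] along [w = v - grad k x] bounds [t * dot w w] by a multiple
    of [t ^+ 2], so [w = 0]. The right-hand side is a first-order formula in [k]; this is how the
    gradient becomes definable. *)
Lemma grad_convexP k (v x : 'rV[R]_n) (C : R) : convex_on_segments k ->
  (forall u, differentiable k u) ->
  (forall u, l1norm (u - x) <= 1 -> bregman k u x <= C * l1norm (u - x) ^+ 2) ->
  grad k x = v <-> (forall u, k x + (dot v u - dot v x) <= k u).
Proof.
move=> ck dk upper; split=> [<- u|sub].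
  by have := bregman_ge0 u ck (dk x); rewrite /bregman dotBr; lra.
apply/esym/eqP; rewrite -subr_eq0; apply/eqP; set w := v - _.
apply: dot_self_eq0; apply/ler_addgt0Pr => e e0; rewrite add0r.
pose l := l1norm w; have l0 : 0 <= l := l1norm_ge0 _.
have Cl : 0 < `|C| * l ^+ 2 + 1 by rewrite ltr_wpDl // mulr_ge0 // sqr_ge0.
have l1 : 0 < (l + 1)^-1 by rewrite invr_gt0; lra.
(* The first bound keeps [x + t *: w] in the region where [upper] applies; the second makes the
   quadratic term at most [t * e]. *)
have [t [t0 tl te]] := common_radius l1 (divr_gt0 e0 Cl).
have xtw : x + t *: w - x = t *: w by rewrite addrAC subrr add0r.
have := upper (x + t *: w); rewrite xtw l1normZ gtr0_norm // -/l.
have tl1 : t * l <= 1.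
  move: tl; rewrite -[_^-1]mul1r ler_pdivlMr; last by lra.
  by rewrite mulrDr mulr1; lra.
move=> /(_ tl1); rewrite /bregman xtw dotZr.
have := sub (x + t *: w); rewrite dotDr dotZr.
move: te; rewrite ler_pdivlMr // => te sub_t upper_t.
have : t * dot w w <= `|C| * (t * l) ^+ 2.
  rewrite dotBl; apply: (@le_trans _ _ (C * (t * l) ^+ 2)); first by lra.
  by apply: ler_wpM2r; [exact: sqr_ge0|exact: ler_norm].
have -> : `|C| * (t * l) ^+ 2 = t * (t * (`|C| * l ^+ 2)) by ring.
rewrite ler_pM2l // => /le_trans; apply; lra.
Qed.

Lemma bregman_upper k rho C : (forall u, differentiable k u) -> 0 <= C ->
  (forall x y a, l1norm x <= rho -> l1norm y <= rho ->
    `|dot (grad k x - grad k y) a| <= C * l1norm (x - y) * l1norm a) ->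
  forall x y, l1norm x <= rho -> l1norm y <= rho ->
    bregman k y x <= C * l1norm (y - x) ^+ 2.
Proof.
move=> dk C0 lip x y xr yr.
have [s [s0 s1]] := @line_mvt _ _ k x (y - x) (fun u => diff_derivable (dk u)).
rewrite derive_grad // subrKC => E; rewrite /bregman E -dotBl.
set u := x + _; have ur : l1norm u <= rho.
  by apply: l1ball_segment => //; rewrite subrKC.
apply: le_trans (ler_norm _) _; apply: le_trans (lip _ _ _ ur xr) _.
rewrite expr2 mulrA; apply: ler_wpM2r; first exact: l1norm_ge0.
apply: ler_wpM2l => //; rewrite /u addrAC subrr add0r l1normZ ger0_norm //.
by rewrite ler_piMl // l1norm_ge0.
Qed.

(** A midpoint stands in for integration along the segment. In the three-point identity at [m] two
    terms are nonnegative, and the third is controlled by monotonicity since [z - m = m - x];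
    halving the vector accounts for the 4. *)
Lemma bregman_lower h rho c : (forall u, differentiable h u) ->
  convex_on_segments h ->
  (forall x y, l1norm x <= rho -> l1norm y <= rho ->
    c * l1norm (x - y) ^+ 2 <= dot (grad h x - grad h y) (x - y)) ->
  forall x z, l1norm x <= rho -> l1norm z <= rho ->
    c / 4 * l1norm (z - x) ^+ 2 <= bregman h z x.
Proof.
move=> dh ch mono x z xr zr.
pose m := x + 2^-1 *: (z - x).
have mr : l1norm m <= rho.
  by apply: l1ball_segment; rewrite ?subrKC // ?invr_ge0 // invf_le1 // ler1n.
have mx : m - x = 2^-1 *: (z - x) by rewrite /m addrAC subrr add0r.
have zm : z - m = m - x.
  rewrite mx /m opprD addrA -[X in X - _]scale1r -scalerBl.
  by congr (_ *: _); lra.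
rewrite (bregman_three_points h x m z) zm.
have := mono m x mr xr; have := bregman_ge0 z ch (dh m).
have := bregman_ge0 m ch (dh x).
have -> : c * l1norm (m - x) ^+ 2 = c / 4 * l1norm (z - x) ^+ 2.
  by rewrite mx l1normZ ger0_norm ?invr_ge0 // exprMn; field.
lra.
Qed.

(** Comparing the distances to [x] from [z] and from its neighbours [z] plus or minus a unit vector
    bounds every coordinate of [grad h x]. The tangent inequality at [x], evaluated at 0, then lets
    [h x] grow at most linearly in [x], against 1-coercivity. *)
Lemma bregman_level_bounded h rho (E : R) : (forall u, differentiable h u) ->
  convex_on_segments h -> one_coercive (EFin \o h) ->
  exists rho', forall z x, l1norm z <= rho -> bregman h z x <= E ->
    l1norm x <= rho'.
Proof.
move=> dh ch coer.
have ch' : continuous h by move=> u; apply: differentiable_continuous.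
have [M [_ hM]] : bounded_set (h @` [set u | l1norm u <= rho + 1]).
  apply: compact_bounded; apply: continuous_compact; last exact: compact_l1ball.
  exact: continuous_subspaceT.
pose H : R := `|M| + 1.
have hH u : l1norm u <= rho + 1 -> `|h u| <= H.
  move=> ur; apply: hM; last by exists u.
  by rewrite (le_lt_trans (ler_norm M)) // ltrDl.
pose V : R := `|E| + 2 * H.
(* [n%:R * V] bounds the l1 norm of the gradient, the other [n%:R] converts [l1norm x] to [enorm x],
   and the rest absorbs [h 0] once [enorm x > 1]. *)
have [r hr] := coer (n%:R * V * n%:R + `|h 0| + 1).
exists (n%:R * Num.max r 1) => z x zr zxE.
apply: le_trans (l1norm_le_enorm x) _; apply: ler_wpM2l => //.
have gradV i : `|grad h x 0 i| <= V.
  have dir (a : R) : `|a| = 1 -> a * grad h x 0 i <= V.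
    move=> a1; pose u : 'rV[R]_n := z + a *: delta_mx 0 i.
    have ur : l1norm u <= rho + 1.
      apply: le_trans (l1normD _ _) _; apply: lerD => //.
      by rewrite l1normZ a1 mul1r l1norm_delta.
    have zr1 : l1norm z <= rho + 1 by lra.
    have := hH _ ur; have := hH _ zr1; rewrite !ler_norml => /andP[? ?] /andP[? ?].
    have := bregman_ge0 u ch (dh x); have := ler_norm E.
    rewrite /bregman in zxE *.
    have -> : dot (grad h x) (u - x) = dot (grad h x) (z - x) + a * grad h x 0 i.
      by rewrite /u addrAC [LHS]dotDr dotZr dot_delta.
    rewrite /V; lra.
  rewrite ler_norml lerNl; apply/andP; split.
    by have := dir (-1); rewrite normrN normr1 mulN1r; apply.
  by have := dir 1; rewrite normr1 mul1r; apply.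
rewrite leNgt gt_max; apply/negP => /andP[xr x1].
have x0 : 0 < enorm x by lra.
have := hr x xr; rewrite /= inver gt_eqF // -EFinM lte_fin ltr_pdivlMr //.
have := bregman_ge0 0 ch (dh x); rewrite /bregman sub0r dotNr.
have gV : l1norm (grad h x) <= n%:R * V by rewrite mulr_natl_sum; apply: ler_sum.
have V0 : 0 <= n%:R * V := le_trans (l1norm_ge0 _) gV.
have := le_trans (ler_norm _) (norm_dot_le (grad h x) x).
have := ler_pM (l1norm_ge0 _) (l1norm_ge0 _) gV (l1norm_le_enorm x).
have : `|h 0| <= `|h 0| * enorm x by rewrite ler_peMr // ltW.
have := ler_norm (h 0); rewrite !mulrDl mul1r mulrA; lra.
Qed.

End bregman_distance.

(** * Forward-backward steps *)

Section definable_dot.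
Variables (R : realType) (S : forall m, set (set 'rV[R]_m)).
Hypothesis oS : o_minimal S.
Variables (T : Type) (cT : coords R T) (n : nat).

Lemma definable_dot (F G : T -> 'rV[R]_n) : definable_fun S F ->
  definable_fun S G -> definable_fun S (fun t => dot (F t) (G t)).
Proof.
by move=> dF dG; apply: (definable_sum oS) => i; definability oS.
Qed.

Lemma definable_l1norm_sub (F G : T -> 'rV[R]_n) : definable_fun S F ->
  definable_fun S G -> definable_fun S (fun t => l1norm (F t - G t)).
Proof.
move=> dF dG; apply: (definable_fun_ext (F := fun t => \sum_i `|F t 0 i - G t 0 i|)).
  by move=> t; apply: eq_bigr => i _; rewrite !mxE.
by apply: (definable_sum oS) => i; definability oS.
Qed.

Lemma definable_l1norm (F : T -> 'rV[R]_n) : definable_fun S F ->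
  definable_fun S (fun t => l1norm (F t)).
Proof.
by move=> dF; apply: (definable_sum oS) => i; definability oS.
Qed.

Lemma definable_egraph (phi : 'rV[R]_n -> \bar R) : S (egraph phi) ->
  definable S (fun p : 'rV[R]_n * R => phi p.1 = p.2%:E).
Proof.
move=> Sphi; exists (fun e => egraph phi (env_row (n + 1) e)).
  by exists (egraph phi).
move=> [v r] /=; rewrite /egraph /=.
have -> : lsubmx (env_row (n + 1) (prod_crd (v, r))) = v.
  by apply/rowP => i; rewrite !mxE prod_crdl //= /rV_crd valK.
by rewrite !mxE /=; have /= -> := @prod_crdr R 'rV[R]_n R _ _ (v, r) 0.
Qed.

End definable_dot.

Section forward_backward.
Variables (R : realType) (n : nat) (f h : 'rV[R]_n -> R).
Variables (g : 'rV[R]_n -> \bar R) (Lf gamma : R).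
Hypothesis f_C2 : C2 f.
Hypothesis h_C2 : C2 h.
Hypothesis h_posdef : forall z, posdef (hess h z).
Hypothesis h_convex : convex_on_segments h.
Hypothesis f_smooth : convex_on_segments (fun u => Lf * h u + -1 * f u).
Hypothesis g_proper : eproper g.
Hypothesis g_lsc : lower_semicontinuous g.
Hypothesis gamma_gt0 : 0 < gamma.
Hypothesis gammaL : gamma * Lf < 1.
Implicit Types (u v w x y z : 'rV[R]_n).

(* The forward-backward model is [cost z + bregman kern z x]. *)
Definition kern u : R := gamma^-1 * h u + -1 * f u.

(* [z] belongs to [fb_map x] and the envelope at [x] is the real number [t]. *)
Definition fb_step (t : R) x z :=
  (exists a, g z = a%:E /\ f z + a + bregman kern z x = t) /\
  forall u b, g u = b%:E -> t <= f u + b + bregman kern u x.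

Lemma f_diff u : differentiable f u. Proof. by case: f_C2. Qed.

Lemma h_diff u : differentiable h u. Proof. by case: h_C2. Qed.

Lemma kern_diff u : differentiable kern u.
Proof.
rewrite (_ : kern = (gamma^-1 \*: h) + (-1 \*: f)); last exact/funext.
by apply: differentiableD; apply: differentiableZ; [exact: h_diff|exact: f_diff].
Qed.

Lemma grad_kern u : grad kern u = gamma^-1 *: grad h u + -1 *: grad f u.
Proof. by rewrite grad_lin //; [exact: h_diff|exact: f_diff]. Qed.

Lemma f_cont : continuous f.
Proof. by move=> u; apply: differentiable_continuous; exact: f_diff. Qed.

Lemma kern_cont : continuous kern.
Proof. by move=> u; apply: differentiable_continuous; exact: kern_diff. Qed.

Lemma grad_kern_cont : continuous (grad kern).
Proof.
rewrite (_ : grad kern = (gamma^-1 \*: grad h) + (-1 \*: grad f)); last first.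
  by apply/funext => u; rewrite grad_kern.
have [_ dh _] := h_C2; have [_ df _] := f_C2.
move=> u; apply: differentiable_continuous.
by apply: differentiableD; apply: differentiableZ.
Qed.

Lemma bregman_kern_cont (T : topologicalType) (F G : T -> 'rV[R]_n) :
  continuous F -> continuous G -> continuous (fun t => bregman kern (F t) (G t)).
Proof.
move=> cF cG.
have ck (H : T -> 'rV[R]_n) : continuous H -> continuous (fun t => kern (H t)).
  by move=> cH t; apply: continuous_comp; [exact: cH|exact: kern_cont].
have cgk : continuous (fun t => grad kern (G t)).
  by move=> t; apply: continuous_comp; [exact: cG|exact: grad_kern_cont].
have cd := dot_continuous cgk (fun t => continuousB (cF t) (cG t)).
by move=> t; apply: cvgB; [apply: cvgB; exact: ck|exact: cd].
Qed.

Lemma gammaVL : Lf < gamma^-1.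
Proof. by rewrite -[gamma^-1]mul1r ltr_pdivlMr // mulrC. Qed.

(** The function [kern] exceeds [(gamma^-1 - Lf) * h] by [Lf * h - f], whose convexity makes its own
    Bregman distance nonnegative. *)
Lemma bregman_kern_ge z x : (gamma^-1 - Lf) * bregman h z x <= bregman kern z x.
Proof.
have dl : differentiable (fun u => Lf * h u + -1 * f u) x.
  rewrite (_ : (fun u => _) = (Lf \*: h) + (-1 \*: f)); last exact/funext.
  by apply: differentiableD; apply: differentiableZ; [exact: h_diff|exact: f_diff].
have := bregman_ge0 z f_smooth dl.
rewrite (bregman_lin _ _ _ (h_diff x) (f_diff x)).
rewrite (bregman_lin _ _ _ (h_diff x) (f_diff x)); lra.
Qed.

Lemma bregman_h_ge0 z x : 0 <= bregman h z x.
Proof. exact: bregman_ge0 h_convex (h_diff x). Qed.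

Lemma bregman_kern_ge0 z x : 0 <= bregman kern z x.
Proof.
apply: le_trans (bregman_kern_ge z x); apply: mulr_ge0; last exact: bregman_h_ge0.
by rewrite subr_ge0 ltW // gammaVL.
Qed.

Lemma kern_convex : convex_on_segments kern.
Proof.
move=> u v t t0 t1; have := f_smooth u v t0 t1.
have := ler_wpM2l (_ : 0 <= gamma^-1 - Lf) (h_convex u v t0 t1).
rewrite subr_ge0 (ltW gammaVL) => /(_ isT); rewrite /kern; nra.
Qed.

Lemma grad_kern_lipschitz rho : exists2 C, 0 < C & forall x y a,
  l1norm x <= rho -> l1norm y <= rho ->
  `|dot (grad kern x - grad kern y) a| <= C * l1norm (x - y) * l1norm a.
Proof.
have [Ch Ch0 hC] := grad_lipschitz rho h_C2.
have [Cf Cf0 fC] := grad_lipschitz rho f_C2.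
exists (gamma^-1 * Ch + Cf + 1).
  by rewrite ltr_wpDl // addr_ge0 // mulr_ge0 // invr_ge0 ltW.
move=> x y a xr yr.
have -> : grad kern x - grad kern y =
    gamma^-1 *: (grad h x - grad h y) - (grad f x - grad f y).
  by rewrite !grad_kern scalerBr !scaleN1r opprD addrACA -opprD.
rewrite [dot _ _]dotBl dotZl.
apply: le_trans (ler_normB _ _) _; rewrite normrM gtr0_norm ?invr_gt0 //.
have Cx := hC x y a xr yr; have Fx := fC x y a xr yr.
have := ler_wpM2l (ltW (_ : 0 < gamma^-1)) Cx; rewrite invr_gt0 => /(_ gamma_gt0).
have := mulr_ge0 (l1norm_ge0 (x - y)) (l1norm_ge0 a).
move: {Cx} Fx; move: (dot _ _) (dot _ _) (l1norm _) (l1norm _) (gamma^-1) => dh df X Y p.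
rewrite !mulrDl !mul1r !mulrA; lra.
Qed.

Lemma bregman_h_lower rho : exists2 c, 0 < c & forall x z,
  l1norm x <= rho -> l1norm z <= rho ->
  c * l1norm (z - x) ^+ 2 <= bregman h z x.
Proof.
have [c c0 mono] := grad_strongly_monotone rho h_C2 h_posdef.
exists (c / 4); first by rewrite divr_gt0.
exact: bregman_lower h_diff h_convex mono.
Qed.

Lemma bregman_h_gt0 z x : z != x -> 0 < bregman h z x.
Proof.
move=> zx; have [c c0 low] := bregman_h_lower (l1norm x + l1norm z).
apply: lt_le_trans (low x z _ _); rewrite ?lerDl ?lerDr ?l1norm_ge0 //.
rewrite mulr_gt0 // exprn_gt0 // lt_neqAle l1norm_ge0 andbT eq_sym.
apply: contra zx => /eqP zx0; rewrite -subr_eq0; apply/eqP/l1norm_eq0.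
by rewrite zx0.
Qed.

Lemma bregman_kernE z x :
  bregman kern z x = gamma^-1 * bregman h z x + -1 * bregman f z x.
Proof. exact: bregman_lin (h_diff x) (f_diff x). Qed.

Lemma fb_modelE x z : fb_model f h g gamma x z =
  (g z + (f z + bregman kern z x)%:E)%E.
Proof.
rewrite /fb_model bregman_kernE addeAC -EFinD addeC; congr (_ + _%:E)%E.
by rewrite [bregman f z x]/bregman; ring.
Qed.

Lemma g_finite z : (g z < +oo)%E -> exists a, g z = a%:E.
Proof.
have [gNy _] := g_proper; have := gNy z.
by case: (g z) => [a| |] // _ _; exists a.
Qed.

Lemma fb_map_step x z : fb_map f h g gamma x z ->
  exists t, fb_step t x z /\ fb_envelope f h g gamma x = t%:E.
Proof.
move=> zmin; have [_ [u0 gu0]] := g_proper.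
have [b0 gb0] := g_finite gu0.
have [a ga] : exists a, g z = a%:E.
  apply: g_finite; have := zmin u0; rewrite !fb_modelE gb0.
  by case: (g z) => //= r _; exact: ltry.
exists (f z + a + bregman kern z x); split.
  split; first by exists a.
  by move=> u b gb; have := zmin u; rewrite !fb_modelE ga gb -!EFinD lee_fin; lra.
apply/eqP; rewrite eq_le; apply/andP; split.
  apply: ge_ereal_inf; exists (fb_model f h g gamma x z); first by exists z.
  by rewrite fb_modelE ga -EFinD lee_fin; lra.
apply: le_ereal_inf_tmp => _ [u _ <-]; apply: le_trans (zmin u).
by rewrite fb_modelE ga -EFinD lee_fin; lra.
Qed.

Lemma linesearch_decrease sigma imax x z d x' z' t t' :
  sigma < (1 - gamma * Lf) / gamma ->
  fb_step t x z -> fb_envelope f h g gamma x = t%:E ->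
  fb_step t' x' z' -> fb_envelope f h g gamma x' = t'%:E ->
  bella_linesearch f h g gamma sigma imax x z d x' ->
  t' <= t - sigma * bregman h z x.
Proof.
move=> sig [[a [ga <-]] _] env_x [_ step'] env_x' [[i [_ acc _ x'E]]|[m [_ _ x'E]]].
  by move: acc; rewrite /bella_accept -x'E env_x env_x' -EFinB lee_fin.
(* Fallback [x' = z]: the model at [z], evaluated at [z], is the cost of [z], that is
   [t - bregman kern z x]; and [sigma] is below [gamma^-1 - Lf]. *)
have := step' z a ga; rewrite x'E bregmanxx.
have : sigma * bregman h z x <= (gamma^-1 - Lf) * bregman h z x.
  apply: ler_wpM2r; first exact: bregman_h_ge0.
  apply: le_trans (ltW sig) _; rewrite mulrBl mul1r [gamma * _]mulrC mulfK //.
  by rewrite gt_eqF.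
have := bregman_kern_ge z x; lra.
Qed.

Lemma cost_le_step t x z : fb_step t x z -> (cost f g z <= t%:E)%E.
Proof.
move=> [[a [ga <-]] _]; rewrite /cost ga -EFinD lee_fin.
by have := bregman_kern_ge0 z x; lra.
Qed.

Definition steps_in_ball rho (t : R) (p : 'rV[R]_n * 'rV[R]_n) :=
  fb_step t p.1 p.2 /\ (l1norm p.1 <= rho /\ l1norm p.2 <= rho).

(** Test minimality at [p.1] with the competitor [q.2], whose cost also occurs in [s] and cancels.
    The three-point identity leaves [bregman kern q.1 p.1], quadratic in [p.1 - q.1], and an inner
    product of a gradient difference with the displacement [q.2 - q.1]. *)
Lemma fb_step_lipschitz rho : exists2 C, 0 < C & forall s t p q,
  steps_in_ball rho t p -> steps_in_ball rho s q -> t - s <=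
  C * l1norm (p.1 - q.1) * (l1norm (p.1 - q.1) + l1norm (q.1 - q.2)).
Proof.
have [C C0 lip] := grad_kern_lipschitz rho; exists C => // s t p q.
move=> [[_ step_t] [xr zr]] [[[a [ga <-]] _] [yr zyr]].
have := step_t _ _ ga; rewrite (bregman_three_points kern p.1 q.1).
have up := bregman_upper kern_diff (ltW C0) lip xr yr.
have := le_trans (ler_norm _) (lip q.1 p.1 (q.2 - q.1) yr xr).
move: up; rewrite ![l1norm (q.1 - p.1)]l1normB [l1norm (q.2 - _)]l1normB expr2.
set l := l1norm _; set l' := l1norm _ => up dots model.
have -> : C * l * (l + l') = C * (l * l) + C * l * l' by ring.
lra.
Qed.

(** As [g] is only lsc, the equation for the value is not closed by itself. Given minimality, it
    amounts to an upper bound on [g z]: that bound is closed by lower semicontinuity, and minimality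
    is an intersection of closed conditions. *)
Lemma closed_fb_step : closed [set p : R * ('rV[R]_n * 'rV[R]_n) |
  fb_step p.1 p.2.1 p.2.2].
Proof.
pose T := (R * ('rV[R]_n * 'rV[R]_n))%type.
have c1 : continuous (fun p : T => p.1) by move=> p; exact: cvg_fst.
have c2 : continuous (fun p : T => p.2) by move=> p; exact: cvg_snd.
have c21 : continuous (fun p : T => p.2.1).
  by move=> p; apply: (@continuous_comp _ _ _ (fun p : T => p.2) fst); [exact: c2|exact: cvg_fst].
have c22 : continuous (fun p : T => p.2.2).
  by move=> p; apply: (@continuous_comp _ _ _ (fun p : T => p.2) snd); [exact: c2|exact: cvg_snd].
pose A (q : 'rV[R]_n * R) := [set p : T |
  0 <= f q.1 + q.2 + bregman kern q.1 p.2.1 - p.1].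
pose c (p : T) := p.1 - f p.2.2 - bregman kern p.2.2 p.2.1.
pose B := [set p : T | (g p.2.2 <= (c p)%:E)%E].
have cc : continuous c.
  have cf : continuous (fun p : T => f p.2.2).
    by move=> p; apply: continuous_comp; [exact: c22|exact: f_cont].
  have cb := bregman_kern_cont c22 c21.
  by move=> p; apply: cvgB; [apply: cvgB; [exact: c1|exact: cf]|exact: cb].
rewrite (_ : [set p | _] = \bigcap_(q in [set q | g q.1 = q.2%:E]) A q `&` B); last first.
  apply/seteqP; split=> [p [[a [ga E]] step]|p [Ap Bp]].
    split=> [q gq|]; first by have := step _ _ gq; rewrite /A /=; lra.
    by rewrite /B /= ga lee_fin /c; lra.
  have step u b : g u = b%:E -> p.1 <= f u + b + bregman kern u p.2.1.
    by move=> gu; have := Ap (u, b) gu; rewrite /A /=; lra.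
  split=> //; have [a ga] : exists a, g p.2.2 = a%:E.
    by apply: g_finite; apply: le_lt_trans Bp _; exact: ltry.
  exists a; split=> //; apply/le_anti; rewrite step // andbT.
  by move: Bp; rewrite /B /= ga lee_fin /c; lra.
apply: closedI.
  apply: closed_bigI => q _.
  apply: (@preimage_closed _ _ (fun p : T => f q.1 + q.2 + bregman kern q.1 p.2.1 - p.1)
    [set x | 0 <= x]); last exact: closed_ge.
  move=> p _; apply: cvgB; last exact: c1.
  apply: cvgD; first exact: cvg_cst.
  exact: (bregman_kern_cont (fun p => cvg_cst _) c21).
rewrite -[B]setCK; apply: open_closedC; rewrite openE => p /= /negP.
rewrite -ltNge => cg.
have [a [ca ag]] : exists a, c p < a /\ (a%:E < g p.2.2)%E.
  move: cg; case: (g p.2.2) => [b| |] //.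
    by rewrite lte_fin => cb; exists ((c p + b) / 2); rewrite lte_fin; split; lra.
  by exists (c p + 1); rewrite ltry; split=> //; lra.
have [V V_nbhs gV] := g_lsc ag.
have near_V : \forall p' \near p, V p'.2.2 by exact: (c22 p).
have near_g : \forall p' \near p, (a%:E < g p'.2.2)%E.
  by apply: filterS near_V => p'; exact: gV.
have near_c : \forall p' \near p, c p' < a by exact: (cvgr_lt _ (cc p)).
rewrite /interior; near=> p' => /=; apply/negP; rewrite -ltNge.
by apply: (@lt_trans _ _ a%:E); [rewrite lte_fin; near: p'|near: p'].
Unshelve. all: by end_near. Qed.

Lemma compact_steps_in_ball rho : compact_slices (steps_in_ball rho).
Proof.
move=> t; pose A := [set u : 'rV[R]_n | l1norm u <= rho].
rewrite (_ : [set w | _] = (A `*` A) `&` [set p | fb_step t p.1 p.2]); last first.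
  by apply/seteqP; split=> p; rewrite /steps_in_ball /A /=; tauto.
apply: compact_closedI; first by apply: compact_setX; exact: compact_l1ball.
apply: (@preimage_closed _ _ (fun p => (t, p)) _ _ closed_fb_step) => p _.
by apply: (@cvg_pair _ _ _ _ (nbhs t) (nbhs p)); [exact: cvg_cst|exact: cvg_id].
Qed.

Lemma definable_steps_in_ball (S : forall m, set (set 'rV[R]_m)) rho :
  o_minimal S -> S _ (egraph (EFin \o f)) -> S _ (egraph g) ->
  S _ (egraph (EFin \o h)) ->
  definable S (fun q : R * ('rV[R]_n * 'rV[R]_n) => steps_in_ball rho q.1 q.2).
Proof.
move=> oS Sf Sg Sh.
have dfin (k : 'rV[R]_n -> R) : S _ (egraph (EFin \o k)) -> definable_fun S k.
  move=> Sk; apply: (definable_ext (P := fun p => (EFin \o k) p.1 = p.2%:E));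
    last exact: definable_egraph.
  move=> [v r] /=.
  by split=> [[]|->].
have df := dfin f Sf; have dh := dfin h Sh.
have [Gr dG GrE] : exists2 Gr : 'rV[R]_n * R -> Prop, definable S Gr &
    forall v a, Gr (v, a) <-> g v = a%:E.
  by exists (fun p => g p.1 = p.2%:E); [exact: definable_egraph|].
have dk' : definable_fun S (fun u => gamma^-1 * h u + -1 * f u).
  by definability oS.
have dk : definable_fun S kern by exact: dk'.
(* The graph of the gradient is rewritten as the subgradient inequality, which avoids any limit. *)
have dgk : definable_fun S (grad kern).
  apply: (definable_ext (P := fun p : 'rV[R]_n * 'rV[R]_n =>
    forall u, kern p.1 + (dot p.2 u - dot p.2 p.1) <= kern u)).
    move=> [x v] /=.
    have [C C0 lip] := grad_kern_lipschitz (l1norm x + 1).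
    have up u : l1norm (u - x) <= 1 ->
        bregman kern u x <= C * l1norm (u - x) ^+ 2.
      move=> ux; apply: (bregman_upper kern_diff (ltW C0) lip); first by rewrite lerDl.
      by rewrite -(subrK x u) addrC; apply: le_trans (l1normD _ _) _; rewrite lerD2l.
    exact: iff_sym (grad_convexP v kern_convex kern_diff up).
  by definability oS; apply: (definable_dot oS); definability oS.
have [D dD DE] : exists2 D : 'rV[R]_n * 'rV[R]_n -> R, definable_fun S D &
    forall z x, D (z, x) = bregman kern z x.
  exists (fun p => kern p.1 - kern p.2 -
    (dot (grad kern p.2) p.1 - dot (grad kern p.2) p.2)); last first.
    by move=> z x; rewrite /bregman dotBr.
  by definability oS; apply: (definable_dot oS); definability oS.
have [N dN NE] : exists2 N : 'rV[R]_n -> R, definable_fun S N &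
    forall u, N u = l1norm u.
  by exists (@l1norm R n) => //; apply: (definable_l1norm oS); definability oS.
apply: (definable_ext (P := fun q : R * ('rV[R]_n * 'rV[R]_n) =>
  ((exists a, Gr (q.2.2, a) /\ f q.2.2 + a + D (q.2.2, q.2.1) = q.1) /\
   forall u b, Gr (u, b) -> q.1 <= f u + b + D (u, q.2.1)) /\
  (N q.2.1 <= rho /\ N q.2.2 <= rho))); last by definability oS.
move=> [t [x z]]; rewrite /steps_in_ball /fb_step /= !NE.
split=> -[[[a [Ga Ea]] step] ball]; split=> //; split.
- by exists a; rewrite -DE; split=> //; apply/GrE.
- by move=> u b /GrE Gb; rewrite -DE; apply: step.
- by exists a; rewrite DE; split=> //; apply/GrE.
- by move=> u b /GrE Gb; rewrite DE; apply: step.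
Qed.

Lemma step_residuals_summable (S : forall m, set (set 'rV[R]_m)) sigma rho m
    (t : nat -> R) (x z : nat -> 'rV[R]_n) :
  o_minimal S -> S _ (egraph (EFin \o f)) -> S _ (egraph g) ->
  S _ (egraph (EFin \o h)) -> 0 < sigma ->
  (forall k, steps_in_ball rho (t k) (x k, z k)) ->
  (forall k, t k.+1 <= t k - sigma * bregman h (z k) (x k)) ->
  (forall k, z k != x k) -> (forall k, m <= t k) ->
  exists B, forall M, \sum_(0 <= k < M) l1norm (x k - z k) <= B.
Proof.
move=> oS Sf Sg Sh sigma0 steps decr zx mt.
(* Strictness places every level above the infimum [p] and keeps consecutive levels distinct, as the
   inequality [KL] below requires. *)
have t_decr k : t k.+1 < t k.
  by apply: le_lt_trans (decr k) _; rewrite gtrBl mulr_gt0 // bregman_h_gt0.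
have t_le i j : (i <= j)%N -> t j <= t i.
  by move=> /subnKC <-; elim: (j - i)%N => [|k IHk];
    rewrite ?addn0 // addnS (le_trans (ltW (t_decr _))).
pose p := inf (range t).
have inf_t : has_inf (range t).
  by split; [exists (t 0%N), 0%N | exists m => _ [k _ <-]].
have pt k : p < t k.
  apply: le_lt_trans (t_decr k); apply: ge_inf; last by exists k.+1.
  by exists m => _ [j _ <-].
have p_near e : 0 < e -> exists k, t k < p + e.
  by move=> e0; have [_ [k _ <-] tk] := inf_adherent e0 inf_t; exists k.
have [C C0 lip] := fb_step_lipschitz rho.
have cfst : continuous (fun w : 'rV[R]_n * 'rV[R]_n => w.1).
  by move=> w; exact: cvg_fst.
have csnd : continuous (fun w : 'rV[R]_n * 'rV[R]_n => w.2).
  by move=> w; exact: cvg_snd.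
have [|||||||||||Th [m' [e [e0 Thm Thle KL]]]] :=
  @desingularization R S oS n ('rV[R]_n * 'rV[R]_n)%type _ fst
    (fun q => l1norm (q.1 - q.2)) (steps_in_ball rho) p rho C.
- by move=> i; exact: coord_comp_continuous cfst.
- by move=> i; definability oS.
- by apply: l1norm_continuous => w; apply: cvgB; [exact: cfst|exact: csnd].
- by apply: (definable_l1norm_sub oS); definability oS.
- by move=> w; exact: l1norm_ge0.
- exact: definable_steps_in_ball.
- exact: compact_steps_in_ball.
- by move=> s w i [_ [wr _]]; apply: le_trans (coord_le_l1norm _ _) wr.
- exact: C0.
- exact: lip.
- move=> e e0; have [k tk] := p_near e e0; exists (t k); split=> //.
  by exists (x k, z k).
have [c c0 low] := bregman_h_lower rho.
(* From index [N] on the levels lie in []p, p + e[]; the first [N] residuals are kept as a separate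
   sum. *)
have [N tN] := p_near e e0.
pose r k := l1norm (x k - z k).
have r0 k : 0 < r k.
  rewrite /r lt_neqAle l1norm_ge0 andbT eq_sym; apply: contra (zx k) => /eqP xz0.
  by rewrite eq_sym -subr_eq0; apply/eqP/l1norm_eq0; rewrite xz0.
have sc0 : 0 < sigma * c by rewrite mulr_gt0.
have step k : (N <= k)%N -> sigma * c * r k <= Th (t k) - Th (t k.+1).
  move=> Nk; rewrite -(ler_pM2l (r0 k)).
  have tke : t k < p + e by apply: le_lt_trans (t_le _ _ Nk) tN.
  apply: le_trans (KL _ _ _ (pt k.+1) (t_decr k) tke (steps k)).
  have [_ [xr zr]] := steps k.
  have := ler_wpM2l (ltW sigma0) (low _ _ xr zr); have := decr k.
  have -> : r k * (sigma * c * r k) = sigma * (c * r k ^+ 2) by ring.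
  rewrite /= [l1norm (z k - _)]l1normB -/(r k); lra.
have sum_le j : sigma * c * \sum_(0 <= k < N + j) r k <=
    sigma * c * \sum_(0 <= k < N) r k + (Th (t N) - Th (t (N + j)%N)).
  elim: j => [|j IHj]; first by rewrite addn0 subrr addr0.
  rewrite addnS big_nat_recr //= mulrDr.
  by have := step (N + j)%N (leq_addr _ _); lra.
exists ((sigma * c * \sum_(0 <= k < N) r k + (Th (t N) - m')) / (sigma * c)) => M.
rewrite ler_pdivlMr // mulrC; apply: (@le_trans _ _ (sigma * c * \sum_(0 <= k < N + M) r k)).
  rewrite ler_pM2l // addnC [leRHS](big_cat_nat _ (leq_addr N M)) //= lerDl.
  by apply: sumr_ge0 => k _; exact: l1norm_ge0.
apply: le_trans (sum_le M) _; rewrite lerD2l lerD2l lerN2; apply: Thm => //.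
by apply: le_lt_trans (t_le _ _ (leq_addr _ _)) tN.
Qed.

(** The cost of [z k] is at most [t k], so level boundedness confines [z k]. The gap between them is
    [bregman kern (z k) (x k)], at most [T - m], and [bregman_level_bounded] then confines [x k]. *)
Lemma steps_bounded (t : nat -> R) (x z : nat -> 'rV[R]_n) (T m : R) :
  one_coercive (EFin \o h) -> level_bounded (cost f g) ->
  (forall u, (m%:E <= cost f g u)%E) ->
  (forall k, fb_step (t k) (x k) (z k)) -> (forall k, t k <= T) ->
  exists rho, forall k, steps_in_ball rho (t k) (x k, z k).
Proof.
move=> coer lev low steps tT.
have [M [_ boundM]] := lev T.
have zM k : l1norm (z k) <= n%:R * (`|M| + 1).
  apply: le_trans (l1norm_le_norm _) _; apply: ler_wpM2l => //.
  apply: boundM; first by rewrite (le_lt_trans (ler_norm M)) // ltrDl.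
  by apply: le_trans (cost_le_step (steps k)) _; rewrite lee_fin.
have gL : 0 < gamma^-1 - Lf by rewrite subr_gt0 gammaVL.
have [rho' xrho] := bregman_level_bounded (n%:R * (`|M| + 1))
  ((T - m) / (gamma^-1 - Lf)) h_diff h_convex coer.
have xM k : l1norm (x k) <= rho'.
  apply: xrho (zM k) _; rewrite ler_pdivlMr // mulrC.
  apply: le_trans (bregman_kern_ge _ _) _.
  have [[a [ga E]] _] := steps k; have := low (z k).
  by rewrite /cost ga -EFinD lee_fin; have := tT k; lra.
exists (Num.max rho' (n%:R * (`|M| + 1))) => k.
by split; [exact: steps | rewrite /= !le_max xM zM orbT].
Qed.

(** Minimality and the three-point identity show that the linearization error of the cost at [z] is
    at least [- bregman kern u z], which is quadratically small in [u - z]. *)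
Lemma step_regular_subdiff t x z : fb_step t x z ->
  regular_subdiff (cost f g) z (grad kern x - grad kern z).
Proof.
move=> [[a [ga E]] step]; split; first by rewrite /cost ga.
have [C C0 lip] := grad_kern_lipschitz (l1norm z + 1).
have up := bregman_upper kern_diff (ltW C0) lip.
rewrite limf_einfE; apply/lee_addgt0Pr => e e0.
(* With this [d] the quadratic error is at most [e * enorm (u - z)], the factor [n] coming from the
   comparison of norms; [d <= 1] keeps [u] in the ball where [C] is valid. *)
have Cn : 0 < C * n%:R + 1 by rewrite ltr_wpDl // mulr_ge0 // ltW.
have [d [d0 d1 de]] := common_radius ltr01 (divr_gt0 e0 Cn).
pose V := [set u : 'rV[R]_n | l1norm (u - z) < d /\ u != z].
have zV : z^' V.
  have near_d : \forall u \near z, l1norm (u - z) < d.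
    have cl : continuous (fun u : 'rV[R]_n => l1norm (u - z)).
      apply: l1norm_continuous => u.
      have id_u : u' @[u' --> u] --> u by [].
      exact: cvgB id_u (cvg_cst z).
    by apply: (cvgr_lt _ (cl z)); rewrite subrr l1norm0.
  rewrite /dnbhs /within /=; near=> u => uz; split=> //.
  by near: u.
apply: (@le_trans _ _ (ereal_inf [set (cost f g u - cost f g z -
    (dot (grad kern x - grad kern z) (u - z))%:E) / (enorm (u - z))%:E | u in V] + e%:E)%E);
  last by apply: leeD2r; apply: ereal_sup_ubound; exists V.
rewrite -leeBlDr // sub0e; apply: le_ereal_inf_tmp => _ [u [ud uz] <-].
have l0 : 0 < l1norm (u - z).
  rewrite lt_neqAle l1norm_ge0 andbT eq_sym; apply: contra uz => /eqP uz0.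
  by rewrite -subr_eq0; apply/eqP/l1norm_eq0; rewrite uz0.
have nen := l1norm_le_enorm (u - z).
have en0 : 0 < enorm (u - z).
  rewrite lt_neqAle enorm_ge0 andbT eq_sym; apply/eqP => en0.
  by rewrite en0 mulr0 leNgt l0 in nen.
rewrite inver gt_eqF // /cost ga.
have [gNy _] := g_proper.
have := gNy u; have := step u; case: (g u) => [b| |] // Hstep _; last first.
  by rewrite addey //= !addye // gt0_mulye ?leey // lte_fin invr_gt0.
rewrite -!EFinD -EFinM -EFinN lee_fin ler_pdivlMr //.
have := Hstep b erefl; rewrite -E (bregman_three_points kern x z u) dotBl.
have ur : l1norm u <= l1norm z + 1.
  rewrite -(subrK z u) addrC; apply: le_trans (l1normD _ _) _; rewrite lerD2l.
  by apply: le_trans (ltW ud) d1.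
have := up z u ltac:(by rewrite lerDl) ur; rewrite expr2 dotBl.
have : C * (l1norm (u - z) * l1norm (u - z)) <= e * enorm (u - z).
  rewrite ler_pdivlMr // in de.
  apply: (@le_trans _ _ (C * (d * (n%:R * enorm (u - z))))).
    by apply: ler_wpM2l; [exact: ltW|apply: ler_pM; rewrite ?l1norm_ge0 // ltW].
  rewrite mulrA mulrA; apply: ler_wpM2r; first exact: enorm_ge0.
  by apply: le_trans de; rewrite mulrDr mulr1 [C * d]mulrC -mulrA lerDl ltW.
lra.
Unshelve. all: by end_near. Qed.

(** By closedness the limit is a step from [xs] to itself, so its level [tl] is the cost of [xs].
    This provides the convergence of costs demanded by the limiting subdifferential, although the
    cost need not be continuous; the subgradients vanish by continuity of [grad kern]. *)
Lemma step_limit_stationary (t : nat -> R) (x z : nat -> 'rV[R]_n)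
    (tl : R) (xs : 'rV[R]_n) :
  (forall k, fb_step (t k) (x k) (z k)) -> t @ \oo --> tl -> x @ \oo --> xs ->
  z @ \oo --> xs -> stationary (cost f g) xs.
Proof.
move=> steps t_tl x_xs z_xs.
have xz_cvg : (fun k => (x k, z k)) @ \oo --> (xs, xs).
  exact: (@cvg_pair _ _ _ _ (nbhs xs) (nbhs xs)).
have txz_cvg : (fun k => (t k, (x k, z k))) @ \oo --> (tl, (xs, xs)).
  exact: (@cvg_pair _ _ _ _ (nbhs tl) (nbhs (xs, xs))).
have steps_near : \forall k \near \oo, [set p : R * ('rV[R]_n * 'rV[R]_n) |
    fb_step p.1 p.2.1 p.2.2] (t k, (x k, z k)).
  by apply: nearW => k; exact: steps.
have [[a [ga E]] _] := closed_cvg _ closed_fb_step steps_near _ txz_cvg.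
rewrite /= in ga E.
rewrite bregmanxx addr0 in E.
have cost_xs : cost f g xs = tl%:E by rewrite /cost ga -EFinD E.
have cfst : continuous (fun w : 'rV[R]_n * 'rV[R]_n => w.1).
  by move=> w; exact: cvg_fst.
have csnd : continuous (fun w : 'rV[R]_n * 'rV[R]_n => w.2).
  by move=> w; exact: cvg_snd.
have breg0 : bregman kern (z k) (x k) @[k --> \oo] --> (0 : R).
  have cb : continuous (fun q : 'rV[R]_n * 'rV[R]_n => bregman kern q.2 q.1).
    exact: bregman_kern_cont csnd cfst.
  by have := cvg_comp _ _ xz_cvg (cb (xs, xs)); rewrite /= bregmanxx.
split; first by rewrite cost_xs.
exists z, (fun k => grad kern (x k) - grad kern (z k)); split=> //.
- rewrite cost_xs (_ : _ \o _ = (fun k => (t k - bregman kern (z k) (x k))%:E)).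
    by apply: cvg_EFin; [exact: nearW|rewrite -[tl]subr0; exact: cvgB].
  apply/funext => k /=; have [[b [gb <-]] _] := steps k.
  by rewrite /cost gb -EFinD addrK.
- by move=> k; apply: step_regular_subdiff (steps k).
- rewrite -(subrr (grad kern xs)); apply: cvgB.
    by apply: (cvg_comp _ _ x_xs); exact: grad_kern_cont.
  by apply: (cvg_comp _ _ z_xs); exact: grad_kern_cont.
Qed.

End forward_backward.

(** * Summability and convergence of the iterates *)

Lemma nneg_series_cvg (R : realType) (u : nat -> R) B : (forall k, 0 <= u k) ->
  (forall N, \sum_(0 <= k < N) u k <= B) -> cvgn (series u).
Proof.
move=> u0 uB; apply: nondecreasing_is_cvgn.
  by apply/nondecreasing_seqP => k; rewrite /series /= big_nat_recr //= lerDl.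
by exists B => _ [N _ <-]; exact: uB.
Qed.

Lemma l1norm_cvg0 (R : realType) n (v : nat -> 'rV[R]_n) :
  (fun k => l1norm (v k)) @ \oo --> (0 : R) -> v @ \oo --> (0 : 'rV[R]_n).
Proof.
move=> v0; apply: norm_cvg0; apply: (squeeze_cvgr _ (cvg_cst 0) v0).
by apply: nearW => k; rewrite normr_ge0 norm_le_l1norm.
Qed.

Lemma real_summable_cvg (R : realType) (u a : nat -> R) :
  (forall k, `|u k.+1 - u k| <= a k) -> cvgn (series a) -> cvgn u.
Proof.
move=> ua ca; have : cvgn (series (telescope u)).
  apply: normed_cvg; apply: series_le_cvg ca => k //=; last exact: ua.
  exact: le_trans (ua k).
move: (u 0%N) (eq_sum_telescope u) => c uE /cvg_ex[l ul].
apply/cvg_ex; exists (c + l).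
have -> : u = cst c + series (telescope u) by apply/funext => k; exact: uE.
exact: cvgD (cvg_cst _) ul.
Qed.

Lemma l1norm_summable_cvg (R : realType) n (x : nat -> 'rV[R]_n) (a : nat -> R) :
  (forall k, l1norm (x k.+1 - x k) <= a k) -> cvgn (series a) -> cvgn x.
Proof.
move=> xa ca.
have /choice[l xl] : forall i, exists l : R, (fun k => x k 0 i) @ \oo --> l.
  move=> i; apply/cvg_ex; apply: real_summable_cvg ca => k.
  by have := coord_le_l1norm (x k.+1 - x k) i; rewrite !mxE => /le_trans; apply.
apply/cvg_ex; exists (\row_i l i).
have d0 : (fun k => x k - \row_i l i) @ \oo --> (0 : 'rV[R]_n).
  apply: l1norm_cvg0; have -> : (0 : R) = \sum_(i < n) 0 by rewrite big1.
  apply: cvg_big => [|i _]; first exact: add_continuous.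
  rewrite -(normr0 R) -(subrr (l i)); apply: cvg_norm.
  rewrite (_ : (fun k => _) = (fun k => x k 0 i - l i)); last first.
    by apply/funext => k; rewrite !mxE.
  by apply: cvgB; [exact: xl | exact: cvg_cst].
rewrite (_ : x = (fun k => x k - \row_i l i + \row_i l i)).
  rewrite -[X in _ --> X]add0r; exact: cvgD d0 (cvg_cst _).
by apply/funext => k; rewrite subrK.
Qed.

Lemma convex_function_on_segments (R : realType) n (k : 'rV[R]_n -> R) :
  convex_function [set: convex_lmodType 'rV[R]_n] k -> convex_on_segments k.
Proof.
move=> ck u v t t0 t1.
have := ck (Itv01 (ltW t0) (ltW t1)) u v; rewrite !inE => /(_ Logic.I Logic.I).
exact.
Qed.

Lemma econvex_on_segments (R : realType) n (k : 'rV[R]_n -> R) :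
  econvex (EFin \o k) -> convex_on_segments k.
Proof.
move=> ck u v t t0 t1; have := ck u v t; rewrite t0 t1 => /(_ isT) /=.
by rewrite -!EFinM -EFinD lee_fin.
Qed.

(** Both outcomes of the line search move [x] by a convex combination of [z - x] and [d], or by
    [z - x] alone, so the bound is uniform in the number of backtracks. *)
Lemma bella_increment_le (R : realType) n (f h : 'rV[R]_n -> R) g gamma sigma imax
    (x z d x' : 'rV[R]_n) :
  bella_linesearch f h g gamma sigma imax x z d x' ->
  l1norm (x' - x) <= l1norm (x - z) + l1norm d.
Proof.
case=> [[i [_ _ _ ->]]|[m [_ _ ->]]]; last first.
  by rewrite l1normB lerDl l1norm_ge0.
rewrite /bella_trial; set a := 2 ^- i.
have a0 : 0 <= a by rewrite invr_ge0 exprn_ge0.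
have a1 : a <= 1 by rewrite invf_le1 ?exprn_gt0 // exprn_ege1 // ler1n.
have -> : (1 - a) *: z + a *: (x + d) - x = (1 - a) *: (z - x) + a *: d.
  by apply/rowP => j; rewrite !mxE; ring.
apply: le_trans (l1normD _ _) _; rewrite !l1normZ !ger0_norm ?subr_ge0 //.
rewrite l1normB; apply: lerD; rewrite ler_piMl ?l1norm_ge0 //; lra.
Qed.


Theorem theorem5p7 (R : realType) (n : nat) (f h : 'rV[R]_n -> R)
    (g : 'rV[R]_n -> \bar R) (Lf gamma sigma : R) (imax : option nat)
    (x xbar d : nat -> 'rV[R]_n) :
  legendre_kernel (EFin \o h) ->
  0 <= Lf -> relatively_smooth f h Lf ->
  eproper g -> lower_semicontinuous g ->
  argmin (cost f g) !=set0 ->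
  0 < gamma -> (gamma%:E < Lf%:E^-1)%E ->
  0 < sigma < (1 - gamma * Lf) / gamma ->
  bella_run f h g gamma sigma 0 imax x xbar d ->
  (forall k, xbar k != x k) ->
  level_bounded (cost f g) ->
  C2 f -> C2 h -> (forall z, posdef (hess h z)) ->
  tame3 (EFin \o f) g (EFin \o h) ->
  cvgn (series (fun k => enorm (x k - xbar k))) /\
  (cvgn (series (fun k => enorm (d k))) \/
     (exists2 D : R, 0 <= D & forall k, enorm (d k) <= D * enorm (x k - xbar k)) ->
   exists xstar : 'rV[R]_n,
     [/\ x @ \oo --> xstar, xbar @ \oo --> xstar
       & stationary (cost f g) xstar]).
Proof.
move=> leg Lf0 [_ smooth] g_pr g_lsc [u0 u0min] gamma0 gammaLinv /andP[sig0 sig1].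
move=> run zx lev f2 h2 pd [S [oS Sf Sg Sh]].
have h_conv := econvex_on_segments (legendre_convex leg).
have f_smooth : convex_on_segments (fun u => Lf * h u + -1 * f u).
  rewrite (_ : (fun u => _) = (fun u => Lf * h u - f u)).
    exact: convex_function_on_segments.
  by apply/funext => u; rewrite mulN1r.
have gammaL : gamma * Lf < 1.
  (* For [Lf = 0] the extended inverse is infinite and the claim reduces to [0 < 1]. *)
  move: gammaLinv; rewrite inver; case: eqP => [->|/eqP Lf1]; first by rewrite mulr0.
  by rewrite lte_fin -[Lf^-1]mul1r ltr_pdivlMr // lt_neqAle eq_sym Lf1.
(* With tolerance 0 the stopping test never succeeds, so [run] constrains every iteration. *)
have bregman_pos k : 0 < bregman h (xbar k) (x k) by apply: bregman_h_gt0.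
have bella k : fb_map f h g gamma (x k) (xbar k) /\
    bella_linesearch f h g gamma sigma imax (x k) (xbar k) (d k) (x k.+1).
  by have [? lines] := run k (fun j _ => bregman_pos j); split=> //; exact: lines.
have /choice[t step_t] : forall k, exists t, fb_step f h g gamma t (x k) (xbar k) /\
    fb_envelope f h g gamma (x k) = t%:E.
  by move=> k; apply: fb_map_step => //; exact: (bella k).1.
have steps k := (step_t k).1.
have decr k : t k.+1 <= t k - sigma * bregman h (xbar k) (x k).
  have [s env] := step_t k; have [s' env'] := step_t k.+1.
  exact: (linesearch_decrease f2 h2 h_conv f_smooth gamma0 sig1 s env s' env'
    (bella k).2).
have t0 k : t k <= t 0%N.
  elim: k => // k; apply: le_trans; apply: le_trans (decr k) _.
  by rewrite gerBl mulr_ge0 // ltW.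
have [m cost_ge] : exists m, forall u, (m%:E <= cost f g u)%E.
  have [gNy [v gv]] := g_pr.
  have [b gb] : exists b, g v = b%:E by apply: g_finite.
  have [a ga] : exists a, g u0 = a%:E.
    apply: (g_finite g_pr); have := u0min v; rewrite /cost gb.
    by case: (g u0) => //= r _; exact: ltry.
  by exists (f u0 + a) => u; have := u0min u; rewrite {1}/cost ga -EFinD.
have mt k : m <= t k.
  rewrite -lee_fin; apply: le_trans (cost_ge (xbar k)) _.
  exact: (cost_le_step f2 h2 h_conv f_smooth gamma0 gammaL (steps k)).
have [rho in_ball] : exists rho, forall k,
    steps_in_ball f h g gamma rho (t k) (x k, xbar k).
  exact: (steps_bounded f2 h2 h_conv f_smooth gamma0 gammaL
    (legendre_coercive leg) lev cost_ge steps t0).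
have [B sumB] : exists B, forall N, \sum_(0 <= k < N) l1norm (x k - xbar k) <= B.
  exact: (step_residuals_summable f2 h2 pd h_conv f_smooth g_pr g_lsc gamma0
    gammaL oS Sf Sg Sh sig0 in_ball decr zx mt).
have cvg_r : cvgn (series (fun k => l1norm (x k - xbar k))).
  by apply: nneg_series_cvg sumB => k; exact: l1norm_ge0.
split.
  apply: series_le_cvg cvg_r => k; [exact: enorm_ge0|exact: l1norm_ge0|].
  exact: enorm_le_l1norm.
move=> d_bound.
(* Either form of the condition on [d] makes its l1 norms summable, the second one through the
   residuals; with [cvg_r] this makes the increments of [x] summable. *)
have cvg_d : cvgn (series (fun k => l1norm (d k))).
  case: d_bound => [cvg_d|[D D0 dD]].
    apply: (@series_le_cvg _ _ (fun k => n%:R * enorm (d k))) => [k|k|k|].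
    - exact: l1norm_ge0.
    - by rewrite mulr_ge0 // enorm_ge0.
    - exact: l1norm_le_enorm.
    exact: (is_cvg_seriesZ (k := n%:R) cvg_d).
  apply: (@series_le_cvg _ _ (fun k => n%:R * D * l1norm (x k - xbar k))) => [k|k|k|].
  - exact: l1norm_ge0.
  - by rewrite !mulr_ge0 // l1norm_ge0.
  - apply: le_trans (l1norm_le_enorm _) _; rewrite -mulrA ler_wpM2l //.
    by apply: le_trans (dD k) _; rewrite ler_wpM2l // enorm_le_l1norm.
  exact: (is_cvg_seriesZ (k := n%:R * D) cvg_r).
have /cvg_ex[xs x_xs] : cvgn x.
  apply: l1norm_summable_cvg (is_cvg_seriesD cvg_r cvg_d) => k.
  exact: bella_increment_le (bella k).2.
have xbar_xs : xbar @ \oo --> xs.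
  have /l1norm_cvg0 r0 := cvg_series_cvg_0 cvg_r.
  rewrite (_ : xbar = (fun k => x k - (x k - xbar k))).
    by rewrite -[xs]subr0; exact: cvgB.
  by apply/funext => k; rewrite subKr.
have t_cvg : cvgn t.
  apply: nonincreasing_is_cvgn; last by exists m => _ [k _ <-].
  apply/nonincreasing_seqP => k; apply: le_trans (decr k) _.
  by rewrite gerBl mulr_ge0 // ltW.
exists xs; split=> //.
exact: (step_limit_stationary f2 h2 g_pr g_lsc gamma0 steps t_cvg x_xs xbar_xs).
Qed.
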